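(* (i) Let $N$ be a nonnegative integer, $\Lambda>0$, and $\delta$ a positive rational number with $2/\delta\notin\{1,\dots,N\}$. Then there exist integers $N',I,J$, rational numbers $\varepsilon',\delta'$, and polynomials $F_1,\dots,F_I,G_1,\dots,G_J\in\mathbb{Z}[A_1,\dots,A_N]$ of degrees at most $N'$ such that for every monic polynomial $Q(z)=\sum_{i=0}^Na_iz^{N-i}$ ($a_0=1$) all of whose zeros lie in $B_{\Lambda/2}$: $\int_{B_\Lambda}|Q(z)|^{-\delta}dV=\infty$ if and only if $G_j(a_1,\dots,a_N)=0$ for all $j$; and otherwise both sides of $$\int_{B_\Lambda}|Q(z)|^{-\delta}dV\ \sim\ \frac{\big(\sum_{i=1}^I|F_i(a_1,\dots,a_N)|^2\big)^{\varepsilon'/2}}{\big(\sum_{j=1}^J|G_j(a_1,\dots,a_N)|^2\big)^{\delta'/2}}$$ are finite and each is bounded by a constant multiple of the other, with constants depending only on $N,\delta,\Lambda$. (ii) When in addition $\delta<4/N$, one can take $I=1$ and $F_1=1$ in (i).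
   Context: $dV$ is Lebesgue measure on $\mathbb{C}$ and $B_r$ the open disk of radius $r$ centered at $0$. *)

(* Defs.v *)
From HB Require Import structures.
From mathcomp Require Import all_boot all_order all_algebra.
From mathcomp Require Import mpoly.
From mathcomp Require Import all_classical all_reals all_analysis.
From mathcomp Require Import complex.
Set Implicit Arguments. Unset Strict Implicit. Unset Printing Implicit Defensive.
Import Order.TTheory GRing.Theory Num.Theory.
Import numFieldNormedType.Exports.
Local Open Scope classical_set_scope.
Local Open Scope ring_scope.

Definition zpoly (N : nat) : Type := {mpoly int[N]}.
Definition zpoly1 (N : nat) : zpoly N := 1.

Section Defs.
Variable R : realType.

Definition cmod (z : R[i]) : R := Num.sqrt (complex.Re z ^+ 2 + complex.Im z ^+ 2).

Definition cpt (p : R * R) : R[i] := Complex p.1 p.2.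

Definition disk (r : R) : set (R * R) := [set p | p.1 ^+ 2 + p.2 ^+ 2 < r ^+ 2].

(* Q(z) = z^N + sum_{i=1}^N a_i z^(N-i); a i stands for a_{i+1} *)
Definition Qpoly (N : nat) (a : 'I_N -> R[i]) (z : R[i]) : R[i] :=
  z ^+ N + \sum_(i < N) a i * z ^+ (N - i.+1).

Definition integrand (N : nat) (a : 'I_N -> R[i]) (delta : R) (p : R * R)
  : \bar R :=
  if Qpoly a (cpt p) == 0 then +oo%E else ((cmod (Qpoly a (cpt p))) `^ (- delta))%:E.

Definition intQ (N : nat) (a : 'I_N -> R[i]) (Lambda delta : R) : \bar R :=
  (\int[(@lebesgue_measure R) \x (@lebesgue_measure R)]_(p in disk Lambda)
      integrand a delta p)%E.

Definition zeval (N : nat) (F : zpoly N) (a : 'I_N -> R[i]) : R[i] :=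
  mpoly.mmap (fun c : int => c%:~R) a F.

Definition deg_le (N : nat) (F : zpoly N) (d : nat) : Prop :=
  (mpoly.msize F <= d.+1)%N.

(* x^e with the usual conventions, in the extended reals:
   0^e = +oo for e < 0, 0^0 = 1, 0^e = 0 for e > 0 *)
Definition epow (x e : R) : \bar R :=
  if (x == 0) && (e < 0) then +oo%E else (x `^ e)%:E.

Definition sumsq (N K : nat) (F : 'I_K -> zpoly N) (a : 'I_N -> R[i]) : R :=
  \sum_(k < K) cmod (zeval (F k) a) ^+ 2.

Definition rhs (N I J : nat) (F : 'I_I -> zpoly N)
  (G : 'I_J -> zpoly N) (eps' delta' : rat) (a : 'I_N -> R[i]) : \bar R :=
  (epow (sumsq F a) (ratr eps' / 2) * epow (sumsq G a) (- (ratr delta' / 2)))%E.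

Definition asymptotic_formula (N : nat) (Lambda : R) (delta : rat)
  (I J : nat) (F : 'I_I -> zpoly N) (G : 'I_J -> zpoly N)
  (eps' delta' : rat) : Prop :=
  exists C1 C2 : R, 0 < C1 /\ 0 < C2 /\
  forall a : 'I_N -> R[i],
    (forall z : R[i], Qpoly a z = 0 -> cmod z < Lambda / 2) ->
    ((intQ a Lambda (ratr delta) = +oo%E <-> forall j, zeval (G j) a = 0) /\
     ((exists j, zeval (G j) a != 0) ->
        intQ a Lambda (ratr delta) \is a fin_num /\
        rhs F G eps' delta' a \is a fin_num /\
        (C1%:E * rhs F G eps' delta' a <= intQ a Lambda (ratr delta))%E /\
        (intQ a Lambda (ratr delta) <= C2%:E * rhs F G eps' delta' a)%E)).

End Defs.

(* Main.v *)
(** Write [delta = D / q] and let [k] be the least integer with [k delta > 2].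
    If [k > N] the integral is bounded above and below by constants.  Otherwise
    let [d_1 <= ... <= d_N] be the distances from a root [al_i] to all the
    roots, and set [E = k D - 2 q] and
    [B_i = d_k ^ E * (d_(k+1) * ... * d_N) ^ D].  Integrating over a square of
    size [d_k] at [al_i] bounds the integral below by a multiple of
    [B_i ^ (-1/q)]; attaching each point to its nearest root and cutting into
    dyadic squares bounds it above by a multiple of the sum of these.

    Up to constants, [B_i] is the sum of the products of [|al_i - al_j| ^ u_j]
    over all [u <= D] of total degree [T = N D - 2 q].  Hence [sum_i 1 / B_i] is
    a quotient of two sums of moduli of polynomials in the roots, each family
    being permuted by the symmetric group.  The maximum modulus of such a family
    [f] is comparable to that of the suitably normalised coefficients of
    [prod_x (X - f x)], which are integer polynomials in the coefficients of
    [Q].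

    If [delta < 4 / N] then [N < 2 k], and [min_i B_i] is itself comparable to
    such a sum: it runs over the products of differences of roots along a
    multigraph of degree at most [D] with [T] edges.  After projecting the roots
    to the real line and sorting them, the edges [(t, t + k - 1)] with
    multiplicity [E] and [(t, t + k)] with multiplicity [D - E] do the job. *)

Require Import Defs.
From HB Require Import structures.
From mathcomp Require Import all_boot all_order all_algebra.
From mathcomp Require Import all_fingroup mpoly.
From mathcomp Require Import all_classical all_reals all_analysis.
From mathcomp Require Import measurable_realfun.
From mathcomp Require Import complex.
From mathcomp Require Import zify ring lra.
Set Implicit Arguments. Unset Strict Implicit. Unset Printing Implicit Defensive.
Import Order.TTheory GRing.Theory Num.Theory.
Local Open Scope ring_scope.

(** * The modulus of complex numbers, with real values *)

Section Modulus.
Variable R : realType.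
Implicit Types z w : R[i].

Lemma cmodE z : (cmod z)%:C%C = `|z|.
Proof. by rewrite normc_def. Qed.

Lemma cmod_ge0 z : 0 <= cmod z.
Proof. exact: sqrtr_ge0. Qed.

Lemma cmodM z w : cmod (z * w) = cmod z * cmod w.
Proof. by apply: complexI; rewrite rmorphM /= !cmodE normrM. Qed.

Lemma cmod1 : cmod (1 : R[i]) = 1.
Proof. by apply: complexI; rewrite cmodE normr1. Qed.

Lemma cmod0 : cmod (0 : R[i]) = 0.
Proof. by apply: complexI; rewrite cmodE normr0. Qed.

Lemma cmodX z n : cmod (z ^+ n) = cmod z ^+ n.
Proof. by apply: complexI; rewrite rmorphXn /= !cmodE normrX. Qed.

Lemma cmod_prod (I : finType) (f : I -> R[i]) :
  cmod (\prod_i f i) = \prod_i cmod (f i).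
Proof. exact: (big_morph _ cmodM cmod1). Qed.

Lemma cmodD z w : cmod (z + w) <= cmod z + cmod w.
Proof. by rewrite -lecR rmorphD /= !cmodE ler_normD. Qed.

Lemma cmodN z : cmod (- z) = cmod z.
Proof. by apply: complexI; rewrite !cmodE normrN. Qed.

Lemma cmodBC z w : cmod (z - w) = cmod (w - z).
Proof. by rewrite -opprB cmodN. Qed.

Lemma cmodB_triangle z w v : cmod (z - v) <= cmod (z - w) + cmod (w - v).
Proof. by rewrite (_ : z - v = z - w + (w - v)) ?cmodD// addrA subrK. Qed.

Lemma cmod_sum (I : finType) (P : pred I) (f : I -> R[i]) :
  cmod (\sum_(i | P i) f i) <= \sum_(i | P i) cmod (f i).
Proof.
apply: (big_ind2 (fun x y => cmod x <= y)) => [|x1 x2 y1 y2 h1 h2|//].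
  by rewrite cmod0.
exact: le_trans (cmodD _ _) (lerD h1 h2).
Qed.

Lemma cmod_eq0 z : (cmod z == 0) = (z == 0).
Proof. by rewrite -(inj_eq (@complexI R)) cmodE normr_eq0. Qed.

Lemma cmod_gt0 z : (0 < cmod z) = (z != 0).
Proof. by rewrite lt_def cmod_eq0 cmod_ge0 andbT. Qed.

End Modulus.

(** * Roots against coefficients of a monic polynomial *)

Section RootBounds.
Variable R : realType.

(** Up to sign the coefficient is an elementary symmetric function: a sum of at most [2 ^ size s]
    products of [size s - i] roots. In the induction each linear factor at most doubles the number
    of terms. *)
Lemma coef_prod_XsubC_le (s : seq R[i]) (x : R) (i : nat) :
  0 <= x -> (forall c, c \in s -> cmod c <= x) -> (i <= size s)%N ->
  cmod (\prod_(c <- s) ('X - c%:P))`_i <= 2 ^+ size s * x ^+ (size s - i).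
Proof.
move=> x0; elim: s i => [|c s IH] i hs hi.
  rewrite big_nil /= coef1; case: i hi => // _.
  by rewrite /= cmod1 !expr0 mul1r.
have hc : cmod c <= x by apply: hs; rewrite inE eqxx.
have {hs} hs : forall c0, c0 \in s -> cmod c0 <= x.
  by move=> c0 h; apply: hs; rewrite inE h orbT.
rewrite big_cons mulrBl coefB coefXM coefCM.
set p := \prod_(_ <- s) _.
have b1 : cmod (if i == 0%N then 0 else p`_i.-1)
    <= 2 ^+ size s * x ^+ ((size s).+1 - i).
  case: i hi => [_|i hi] /=.
    by rewrite cmod0 mulr_ge0 ?exprn_ge0.
  by rewrite subSS; apply: IH.
have b2 : cmod (c * p`_i) <= 2 ^+ size s * x ^+ ((size s).+1 - i).
  move: hi; rewrite leq_eqVlt => /orP[/eqP ->|hi] /=.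
    rewrite nth_default ?mulr0 ?cmod0 ?mulr_ge0 ?exprn_ge0 //.
    by rewrite /p size_prod_XsubC.
  rewrite cmodM subSn // exprS mulrCA; apply: ler_pM; rewrite ?cmod_ge0 //.
  exact: IH.
apply: le_trans (cmodD _ _) _; rewrite cmodN /= exprS -mulrA mulr_natl mulr2n.
exact: lerD.
Qed.

Lemma geometric_sum_lt (x y : R) (n : nat) : 0 <= x -> 2 * x < y ->
  \sum_(i < n) x ^+ (n - i) * y ^+ i < y ^+ n.
Proof.
move=> x0 xy; have y0 : 0 < y by apply: le_lt_trans xy; rewrite mulr_ge0.
elim: n => [|n IH]; first by rewrite big_ord0 expr0.
rewrite big_ord_recr /= subSnn expr1.
under eq_bigr => i _ do rewrite subSn ?(ltnW (ltn_ord i)) // exprS -mulrA.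
rewrite -mulr_sumr -mulrDr exprS.
have := exprn_gt0 n y0; set s := \sum_(_ < _) _ in IH *.
have s0 : 0 <= s.
  by apply: sumr_ge0 => i _; rewrite mulr_ge0 ?exprn_ge0 // ltW.
(* The sum for [n + 1] is [x * (s + v)]; as [s < v], it is at most [2 * x * v < y * v]. *)
move: IH; set v := y ^+ n => IH v0; nra.
Qed.

(** At a root of modulus above [2 * x] the leading term would exceed the sum of all the others, by
    [geometric_sum_lt]. *)
Lemma root_prod_XsubC_le (s : seq R[i]) (x : R) (z : R[i]) :
  0 <= x -> z \in s ->
  (forall j, (0 < j <= size s)%N ->
     cmod (\prod_(c <- s) ('X - c%:P))`_(size s - j) <= x ^+ j) ->
  cmod z <= 2 * x.
Proof.
move=> x0 zs h; rewrite leNgt; apply/negP => hz.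
set p := \prod_(c <- s) _ in h.
have : p.[z] = 0 by apply/eqP; rewrite -/(root p z) root_prod_XsubC.
rewrite horner_coef size_prod_XsubC big_ord_recr /=.
have -> : p`_(size s) = 1.
  have := monic_prod_XsubC s predT id.
  by rewrite monicE lead_coefE size_prod_XsubC => /eqP.
rewrite mul1r => /eqP; rewrite addrC addr_eq0 => /eqP hzn.
have := geometric_sum_lt (size s) x0 hz; rewrite ltNge => /negP; apply.
rewrite -cmodX hzn cmodN; apply: le_trans (cmod_sum _ _) _.
apply: ler_sum => i _; rewrite cmodM cmodX ler_wpM2r ?exprn_ge0 ?cmod_ge0 //.
have hi := ltn_ord i.
have -> : p`_i = p`_(size s - (size s - i)) by rewrite subKn // ltnW.
by apply: h; rewrite subn_gt0 hi leq_subr.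
Qed.

End RootBounds.

(** * Norms of symmetric families as polynomials in the coefficients *)

Section SymmetricFamilies.
Variables (R : realType) (N : nat).
Implicit Types (a al : 'I_N -> R[i]) (p : zpoly N).

Lemma zevalXU i al : zeval ('X_i : zpoly N) al = al i.
Proof. by rewrite /zeval mmapX mmap1U. Qed.

Lemma zeval_comp (n : nat) (p : {mpoly int[n]}) (lq : n.-tuple (zpoly N)) al :
  zeval (p \mPo lq : zpoly N) al
  = zeval (p : zpoly n) (fun i => zeval (tnth lq i) al).
Proof.
rewrite comp_mpolyEX {1}/zeval raddf_sum; apply: eq_bigr => m _.
rewrite comp_mpolyX [LHS]mmapZ; congr (_ * _).
rewrite rmorph_prod; apply: eq_bigr => i _; exact: rmorphXn.
Qed.

Lemma zeval_mesym (k : nat) al :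
  zeval (mesym N int k) al = (mesym N R[i] k).@[al].
Proof.
rewrite /mesym /zeval !rmorph_sum /=; apply: eq_bigr => h _.
rewrite !rmorph_prod /=; apply: eq_bigr => i _.
by rewrite mevalXU; exact: zevalXU.
Qed.

Definition vieta a al : Prop :=
  forall i : 'I_N, a i = (\prod_j ('X - (al j)%:P))`_(N - i.+1).

Lemma vieta_mesym a al (i : 'I_N) : vieta a al ->
  zeval (mesym N int i.+1) al = (-1) ^+ i.+1 * a i.
Proof.
move=> ->; have := mroots_coeff [tuple al j | j < N] (lift ord0 i).
rewrite lift0 [\prod_(c <- _) _](_ : _ = \prod_j ('X - (al j)%:P)); last first.
  by rewrite big_tuple; apply: eq_bigr => j _; rewrite tnth_mktuple.
move=> ->; rewrite mulrA -exprD addnn -mul2n exprM sqrrN expr1n expr1n mul1r.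
rewrite zeval_mesym; apply: meval_eq => j; by rewrite tnth_mktuple.
Qed.

(** The fundamental theorem of symmetric polynomials, over the integers, followed by a change of
    sign of the odd-degree elementary symmetric functions that absorbs Vieta's signs. *)
Lemma symmetric_zeval p : p \is symmetric ->
  exists G : zpoly N, forall a al, vieta a al -> zeval G a = zeval p al.
Proof.
move=> /sym_fundamental [t [<- _]].
exists (t \mPo [tuple (-1) ^+ i.+1 *: ('X_i : zpoly N) | i < N]) => a al va.
rewrite !zeval_comp; congr (zeval _ _); apply/funext => i.
rewrite !tnth_mktuple (vieta_mesym _ va) [LHS]mmapZ rmorphXn rmorphN rmorph1.
by congr (_ * _); exact: zevalXU.
Qed.

Section Family.
Variables (X : finType) (f : X -> zpoly N).
Hypothesis f_perm : forall s : 'S_N,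
  exists2 pi : X -> X, injective pi & forall x, msym s (f x) = f (pi x).

Let chi : {poly {mpoly int[N]}} := \prod_x ('X - (f x)%:P).

(** A permutation of the variables permutes the factors of [chi]. *)
Let chi_sym i : chi`_i \is symmetric.
Proof.
apply/issymP => s; have [pi pi_inj hpi] := f_perm s.
suff E : map_poly (msym s) chi = chi by rewrite -[in RHS]E coef_map.
rewrite /chi rmorph_prod [RHS](reindex_inj pi_inj); apply: eq_bigr => x _.
by rewrite rmorphB /= map_polyX map_polyC /= hpi.
Qed.

Let zeval_chi al i :
  zeval chi`_i al = (\prod_(c <- [seq zeval (f x) al | x : X]) ('X - c%:P))`_i.
Proof.
rewrite big_map big_enum /=.
suff <- : map_poly (mmap intr al) chi
    = \prod_x ('X - (zeval (f x) al)%:P) by rewrite coef_map.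
rewrite /chi rmorph_prod; apply: eq_bigr => x _.
by rewrite rmorphB /= map_polyX map_polyC.
Qed.

(** The coefficient of [chi] of index [M - (j + 1)] has degree [j + 1] in the members of the family,
    so its power [K / (j + 1)] has degree [K] for every [j], and the sum of squares scales like
    [S ^ (2 K)]. One inequality bounds roots by coefficients, the other coefficients by roots. *)
Lemma symmetric_family_norm :
  exists (J K : nat) (G : 'I_J -> zpoly N) (C : R), [/\ (0 < K)%N, 0 < C &
    forall a al, vieta a al ->
      let S := \sum_x cmod (zeval (f x) al) in
      S ^+ (2 * K) <= C * sumsq G a /\ sumsq G a <= C * S ^+ (2 * K)].
Proof.
(* The factorial makes [K] divisible by all the degrees [j + 1 <= M]. *)
pose M := #|X|; pose K := M`!.
have K0 : (0 < K)%N by rewrite fact_gt0.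
have KE (j : 'I_M) : (K = j.+1 * (K %/ j.+1))%N.
  by rewrite mulnC divnK // dvdn_fact /=.
have ex_G (j : 'I_M) : exists G : zpoly N, forall a al, vieta a al ->
    zeval G a = zeval (chi`_(M - j.+1)) al ^+ (K %/ j.+1).
  have [|G hG] := @symmetric_zeval (chi`_(M - j.+1) ^+ (K %/ j.+1)).
    by apply: rpredX; apply: chi_sym.
  by exists G => a al va; rewrite (hG a al va) [LHS]rmorphXn.
pose G (j : 'I_M) := projT1 (cid (ex_G j)).
have hG j : forall a al, vieta a al ->
    zeval (G j) a = zeval (chi`_(M - j.+1)) al ^+ (K %/ j.+1).
  exact: projT2 (cid (ex_G j)).
pose C1 : R := (2 * M%:R) ^+ (2 * K); pose C2 : R := M%:R * (2 ^+ M) ^+ (2 * K).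
have C10 : 0 <= C1 by rewrite exprn_ge0 // mulr_ge0.
have C20 : 0 <= C2 by rewrite mulr_ge0 ?exprn_ge0 ?exprn_ge0.
exists M, K, G, (1 + C1 + C2); split => // [|a al va S].
  by rewrite -addrA ltr_wpDr // addr_ge0.
have S0 : 0 <= S by apply: sumr_ge0 => x _; exact: cmod_ge0.
have Y0 : 0 <= sumsq G a by apply: sumr_ge0 => j _; rewrite exprn_ge0 ?cmod_ge0.
set s := [seq zeval (f x) al | x : X].
have sM : size s = M by rewrite size_map -cardE.
have hGa (j : 'I_M) : cmod (zeval (G j) a) ^+ 2
    = cmod (\prod_(c <- s) ('X - c%:P))`_(M - j.+1) ^+ (2 * (K %/ j.+1)).
  by rewrite (hG _ _ _ va) cmodX zeval_chi -exprM mulnC.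
split.
(* With this [x] the coefficient of degree [j + 1] has modulus at most [x ^ (j + 1)], as
   [root_prod_XsubC_le] asks. *)
- pose x := sumsq G a `^ ((2 * K)%:R^-1).
  have x0 : 0 <= x by exact: powR_ge0.
  have xE : x ^+ (2 * K) = sumsq G a.
    rewrite -powR_mulrn // -powRrM mulVf ?powRr1 // pnatr_eq0 muln_eq0 /=.
    by rewrite -lt0n.
  have hx y : y \in s -> cmod y <= 2 * x.
    move=> ys; apply: (root_prod_XsubC_le x0 ys) => -[//|j] /=; rewrite sM => hj.
    have := KE (Ordinal hj) => /= KEj.
    have j0 : (0 < K %/ j.+1)%N.
      by rewrite divn_gt0 // (leq_trans hj) // fact_geq.
    rewrite -(@ler_pXn2r _ (2 * (K %/ j.+1))) ?muln_gt0 ?nnegrE ?cmod_ge0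
      ?exprn_ge0 // -exprM mulnCA -KEj xE.
    have := hGa (Ordinal hj) => /= <-.
    rewrite /sumsq (bigD1 (Ordinal hj)) //= lerDl.
    by apply: sumr_ge0 => i _; rewrite exprn_ge0 ?cmod_ge0.
  have : S <= 2 * M%:R * x.
    rewrite mulrAC -[M]/(#|X|) -sum1_card natr_sum mulr_sumr.
    apply: ler_sum => y _; rewrite mulr1; apply: hx.
    by apply: map_f; rewrite mem_enum.
  move=> hS; apply: le_trans (_ : C1 * sumsq G a <= _); last first.
    by rewrite ler_wpM2r //; lra.
  by rewrite -xE /C1 -exprMn lerXn2r ?nnegrE // !mulr_ge0.
- have hx y : y \in s -> cmod y <= S.
    move=> /mapP[x _ ->]; rewrite /S (bigD1 x) //= lerDl.
    by apply: sumr_ge0 => ? _; exact: cmod_ge0.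
  apply: le_trans (_ : C2 * S ^+ (2 * K) <= _); last first.
    by rewrite ler_wpM2r ?exprn_ge0 //; lra.
  rewrite /C2 -mulrA -exprMn -[M in M%:R]card_ord -sum1_card natr_sum mulr_suml.
  apply: ler_sum => j _; rewrite mul1r hGa.
  have hj := coef_prod_XsubC_le (i := M - j.+1) S0 hx.
  rewrite sM in hj; have {}hj := hj (leq_subr _ _); rewrite subKn // in hj.
  apply: le_trans (_ : (2 ^+ M * S ^+ j.+1) ^+ (2 * (K %/ j.+1)) <= _).
    by rewrite lerXn2r ?nnegrE ?cmod_ge0 ?mulr_ge0 ?exprn_ge0.
  rewrite !exprMn -(exprM S) mulnCA -KE ler_wpM2r ?exprn_ge0 //.
  by rewrite ler_weXn2l ?leq_mul2l ?leq_div // exprn_ege1 // ler1n.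
Qed.

End Family.
End SymmetricFamilies.

(** * Products of distances with bounded exponents *)

Section Knapsack.
Variables (R : realType) (N : nat).

Lemma sorting_perm (f : 'I_N -> R) :
  exists s : 'S_N, forall i j : 'I_N, (i <= j)%N -> f (s i) <= f (s j).
Proof.
pose r := fun i j : 'I_N => f i <= f j.
pose l := sort r (enum 'I_N).
have sl : size l == N by rewrite size_sort size_enum_ord.
pose tl := Tuple sl.
have inj : injective (tnth tl).
  by apply/tuple_uniqP; rewrite sort_uniq enum_uniq.
exists (perm inj) => i j ij; rewrite !permE.
have tr : transitive r by move=> ? ? ?; exact: le_trans.
have so : sorted r l by apply: sort_sorted => ? ?; exact: le_total.
rewrite !(tnth_nth i); apply: (sorted_leq_nth tr _ i so); rewrite ?inE ?(eqP sl) //.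
by move=> ?; exact: lexx.
Qed.

(** The [k]-th smallest value is [d j0], and [H] indexes the [N - k] values after it; the sort
    breaks ties. *)
Lemma kth_split (d : 'I_N -> R) (k : nat) : (0 < k <= N)%N ->
  exists (H : {set 'I_N}) (j0 : 'I_N), [/\ #|H| = (N - k)%N, j0 \notin H,
    forall j, j \notin H -> d j <= d j0 & forall j, j \in H -> d j0 <= d j].
Proof.
move=> /andP[k0 kN]; have [s hs] := sorting_perm d.
have k1N : (k.-1 < N)%N by rewrite prednK.
pose A : {set 'I_N} := [set t : 'I_N | (k <= t)%N].
have cA : #|A| = (N - k)%N.
  have : #|~: A| = k.
    have -> : ~: A = [set widen_ord kN t | t : 'I_k].
      apply/setP => t; rewrite !inE -ltnNge; apply/idP/imsetP => [tk|[u _ ->]].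
        by exists (Ordinal tk) => //; apply: val_inj.
      by rewrite /=.
    by rewrite card_imset ?card_ord // => x y /(congr1 val) /= /val_inj.
  by have := cardsC A; rewrite card_ord; lia.
exists (s @: A), (s (Ordinal k1N)); split => [||j|j].
- by rewrite card_imset //; exact: perm_inj.
- by rewrite mem_imset ?inE /=; [lia | exact: perm_inj].
- rewrite -[j](permKV s) mem_imset; last exact: perm_inj.
  by rewrite inE => h; apply: hs => /=; lia.
- case/imsetP => t; rewrite inE => h ->; apply: hs => /=; lia.
Qed.

(** The indices in [H] have spare capacity [D - u j], and the exponents outside [H] add up to [E]
    plus that capacity. Once each base outside [H] is replaced by [rho], all but [E] of these
    factors move into [H], where [rho <= x j]. *)
Lemma knapsack_le (H : {set 'I_N}) (d x : 'I_N -> R) (rho : R)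
    (u : 'I_N -> nat) (D E : nat) :
  0 <= rho -> (forall j, 0 <= d j) ->
  (forall j, j \notin H -> d j <= rho) ->
  (forall j, j \in H -> d j <= x j /\ rho <= x j) ->
  (forall j, u j <= D)%N -> (\sum_j u j = E + #|H| * D)%N ->
  \prod_j d j ^+ u j <= rho ^+ E * \prod_(j in H) x j ^+ D.
Proof.
move=> rho0 d0 dn dH uD su.
have uE : (\sum_(j | j \notin H) u j = E + \sum_(j in H) (D - u j))%N.
  have : (\sum_(j in H) u j + \sum_(j in H) (D - u j) = #|H| * D)%N.
    rewrite -big_split /= -sum_nat_const; apply: eq_bigr => j _.
    by have := uD j; lia.
  move=> h; apply/eqP; rewrite -(eqn_add2l (\sum_(j in H) u j)%N) addnCA h -su.
  by rewrite [X in _ == X](bigID (fun j => j \in H)).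
rewrite (bigID (fun j => j \in H)) /= mulrC.
apply: le_trans (_ : (rho ^+ E * \prod_(j in H) x j ^+ (D - u j))
    * \prod_(j in H) x j ^+ u j <= _); last first.
  rewrite -mulrA -big_split /= ler_wpM2l ?exprn_ge0 //.
  rewrite le_eqVlt; apply/orP; left; apply/eqP; apply: eq_bigr => j _.
  by rewrite -exprD subnK.
apply: ler_pM.
- by apply: prodr_ge0 => j _; rewrite exprn_ge0.
- by apply: prodr_ge0 => j _; rewrite exprn_ge0.
- apply: le_trans (_ : \prod_(j | j \notin H) rho ^+ u j <= _).
    apply: ler_prod => j jH; rewrite exprn_ge0 //= lerXn2r ?nnegrE //.
    exact: dn.
  rewrite prodrXr uE exprD ler_wpM2l ?exprn_ge0 // -prodrXr.
  apply: ler_prod => j /dH[_ h]; rewrite exprn_ge0 //= lerXn2r ?nnegrE //.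
  exact: le_trans h.
- apply: ler_prod => j /dH[h _]; rewrite exprn_ge0 //= lerXn2r ?nnegrE //.
  exact: le_trans h.
Qed.

Variables D T : nat.

(** A symmetric substitute for the product [d_k ^ E * (d_(k+1) * ... * d_N) ^ D] of sorted values,
    comparable to it when [T = E + (N - k) * D] and [E <= D]. *)
Definition Bsum (d : 'I_N -> R) : R :=
  \sum_(u : {ffun 'I_N -> 'I_D.+1} | (\sum_j u j == T)%N) \prod_j d j ^+ u j.

Definition Bcard : nat := #|{: {ffun 'I_N -> 'I_D.+1}}|.

Lemma Bsum_ge0 d : (forall j, 0 <= d j) -> 0 <= Bsum d.
Proof.
by move=> d0; apply: sumr_ge0 => u _; apply: prodr_ge0 => j _; rewrite exprn_ge0.
Qed.

Lemma Bsum_ge_term d (u : 'I_N -> nat) : (forall j, 0 <= d j) ->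
  (forall j, u j <= D)%N -> (\sum_j u j = T)%N -> \prod_j d j ^+ u j <= Bsum d.
Proof.
move=> d0 uD su; pose v : {ffun 'I_N -> 'I_D.+1} := [ffun j => inord (u j)].
have vE j : v j = u j :> nat by rewrite ffunE inordK ?ltnS.
rewrite /Bsum (bigD1 v) /=; last first.
  by under eq_bigr => j _ do rewrite vE; exact/eqP.
rewrite (eq_bigr (fun j => d j ^+ v j)) => [|j _]; last by rewrite vE.
rewrite lerDl; apply: sumr_ge0 => w _.
by apply: prodr_ge0 => j _; rewrite exprn_ge0.
Qed.

Lemma Bsum_le (d : 'I_N -> R) (M : R) : 0 <= M ->
  (forall u : {ffun 'I_N -> 'I_D.+1},
     (\sum_j u j)%N = T -> \prod_j d j ^+ u j <= M) ->
  Bsum d <= Bcard%:R * M.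
Proof.
move=> M0 h; rewrite /Bcard -sum1_card natr_sum mulr_suml /Bsum big_mkcond /=.
apply: ler_sum => u _; rewrite mul1r; case: eqP => // hu; exact: h.
Qed.

Lemma Bsum_scale (d d' : 'I_N -> R) (c : R) : (forall j, 0 <= d' j) ->
  (forall j, d' j <= c * d j) -> Bsum d' <= c ^+ T * Bsum d.
Proof.
move=> d0 h; rewrite /Bsum mulr_sumr; apply: ler_sum => u /eqP <-.
rewrite -prodrXr -big_split /=; apply: ler_prod => j _.
rewrite exprn_ge0 //= -exprMn lerXn2r ?nnegrE //; exact: le_trans (h j).
Qed.

Lemma Bsum_perm (d : 'I_N -> R) (s : 'S_N) : Bsum (d \o s) = Bsum d.
Proof.
pose h (u : {ffun 'I_N -> 'I_D.+1}) : {ffun 'I_N -> 'I_D.+1} := [ffun j => u (s j)].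
have hK : cancel h (fun u => [ffun j => u ((s^-1)%g j)]).
  by move=> u; apply/ffunP => j; rewrite !ffunE permKV.
rewrite /Bsum (reindex_inj (can_inj hK)) /=; apply: eq_big => u.
  rewrite [in RHS](reindex_inj (@perm_inj _ s)) /=.
  by congr (_ == _); apply: eq_bigr => j _; rewrite ffunE.
move=> _; rewrite [in RHS](reindex_inj (@perm_inj _ s)) /=.
by apply: eq_bigr => j _; rewrite ffunE.
Qed.

(** The product is one of the terms: exponent [D] on [H], [E] at [j0] and [0] elsewhere. *)
Lemma Bsum_lower (d : 'I_N -> R) (H : {set 'I_N}) (j0 : 'I_N) (E : nat) :
  (forall j, 0 <= d j) -> j0 \notin H -> (E <= D)%N -> T = (E + #|H| * D)%N ->
  d j0 ^+ E * \prod_(j in H) d j ^+ D <= Bsum d.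
Proof.
move=> d0 j0H ED TE.
pose u (j : 'I_N) := if j \in H then D else if j == j0 then E else 0%N.
apply: le_trans (Bsum_ge_term d0 (u := u) _ _).
- rewrite [X in _ <= X](bigID (fun j => j \in H)) /= mulrC.
  rewrite [X in _ <= _ * X](bigD1 j0) //= [X in _ <= _ * (_ * X)]big1 ?mulr1.
    rewrite /u (negbTE j0H) eqxx ler_wpM2r ?exprn_ge0 //.
    rewrite le_eqVlt; apply/orP; left; apply/eqP; apply: eq_bigr => j.
    by rewrite /u => ->.
  by move=> j /andP[/negbTE jH /negbTE jj]; rewrite /u jH jj expr0.
- by move=> j; rewrite /u; case: ifP => // _; case: ifP.
- rewrite (bigID (fun j => j \in H)) /= (eq_bigr (fun=> D)); last first.
    by move=> j; rewrite /u => ->.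
  rewrite sum_nat_const (bigD1 j0) //= big1; last first.
    by move=> j /andP[/negbTE jH /negbTE jj]; rewrite /u jH jj.
  by rewrite /u (negbTE j0H) eqxx addn0 TE addnC.
Qed.

(* Each edge is charged to whichever endpoint has the larger [d]. *)
Lemma multigraph_le_Bsum (Z : finType) (s t : Z -> 'I_N) (m : Z -> nat)
    (e : Z -> R) (d : 'I_N -> R) :
  (forall j, 0 <= d j) ->
  (forall z, 0 <= e z <= 2 * Num.max (d (s z)) (d (t z))) ->
  (forall v, \sum_z m z * ((s z == v) + (t z == v)) <= D)%N ->
  (\sum_z m z = T)%N ->
  \prod_z e z ^+ m z <= 2 ^+ T * Bsum d.
Proof.
move=> d0 he deg tot.
pose far z := if d (s z) <= d (t z) then t z else s z.
pose u v := (\sum_z m z * (far z == v))%N.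
have -> : 2 ^+ T = \prod_z (2 : R) ^+ m z by rewrite prodrXr tot.
apply: le_trans (_ : (\prod_z 2 ^+ m z) * \prod_z d (far z) ^+ m z <= _).
  rewrite -big_split /=; apply: ler_prod => z _; have /andP[e0 e1] := he z.
  rewrite exprn_ge0 //= -exprMn lerXn2r ?nnegrE ?mulr_ge0 //.
  apply: le_trans e1 _; rewrite ler_wpM2l // /far.
  by case: ifP => h; [rewrite max_r | rewrite max_l // ltW // ltNge h].
apply: ler_wpM2l; first by apply: prodr_ge0 => z _; rewrite exprn_ge0.
apply: le_trans (Bsum_ge_term d0 (u := u) _ _).
- rewrite le_eqVlt; apply/orP; left; apply/eqP.
  under [RHS]eq_bigr => v _ do rewrite -prodrXr.
  rewrite exchange_big /=; apply: eq_bigr => z _.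
  rewrite (bigD1 (far z)) //= eqxx muln1 big1 ?mulr1 // => v /negbTE.
  by rewrite eq_sym => ->; rewrite muln0.
- move=> v; apply: leq_trans (deg v); apply: leq_sum => z _.
  by rewrite leq_mul2l /far; case: ifP => _; rewrite ?leq_addl ?leq_addr orbT.
- rewrite -tot exchange_big /=; apply: eq_bigr => z _.
  rewrite (bigD1 (far z)) //= eqxx muln1 big1 ?addn0 // => v /negbTE.
  by rewrite eq_sym => ->; rewrite muln0.
Qed.

End Knapsack.

(** * The multigraph of windows on sorted points of the line *)

Section Windows.
Variables (n k D E : nat).
Hypotheses (k_gt0 : (0 < k)%N) (k_le : (k <= n.+1)%N) (n_lt : (n.+1 < 2 * k)%N).
Hypotheses (ED : (E <= D)%N) (E_half : (n.+2 = 2 * k)%N -> (2 * E <= D)%N).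

(** The left summand codes the [N - k + 1] pairs of indices at distance [k - 1], the right one the
    [N - k] pairs at distance [k], where [N = n + 1]. *)
Definition edge : finType := ('I_(n.+1 - k).+1 + 'I_(n.+1 - k))%type.

Definition esrc (z : edge) : 'I_n.+1 :=
  match z with inl t => inord t | inr t => inord t end.
Definition etgt (z : edge) : 'I_n.+1 :=
  match z with inl t => inord (t + k.-1) | inr t => inord (t + k) end.
Definition emul (z : edge) : nat :=
  match z with inl _ => E | inr _ => (D - E)%N end.

Lemma sum_eq_shift (m b v : nat) :
  (\sum_(t < m) (t + b == v) <= (b <= v < m + b))%N.
Proof.
have [h|h] := boolP (b <= v < m + b)%N; last first.
  rewrite big1 // => t _; apply/eqP; rewrite eqb0; apply: contra h => /eqP <-.
  by rewrite leq_addl ltn_add2r ltn_ord.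
have hm : (v - b < m)%N by lia.
rewrite (bigD1 (Ordinal hm)) //= big1 ?addn0 ?leq_b1 // => t.
by rewrite -val_eqE /= => ht; apply/eqP; rewrite eqb0; lia.
Qed.

(** A vertex starts at most one edge of each kind and ends at most one of each, which costs
    [E + (D - E) = D] on either side. Since [n + 2 <= 2 k], only the vertex [k - 1] can be on both
    sides, when [n + 2 = 2 k]; it then meets two edges of multiplicity [E] and no other, whence
    [E_half]. *)
Lemma sum_emul (v : 'I_n.+1) :
  (\sum_z emul z * ((esrc z == v) + (etgt z == v)) <= D)%N.
Proof.
have le_e (m b : nat) (g : 'I_m -> 'I_n.+1) :
    (forall t, g t = (t + b)%N :> nat) ->
    (\sum_(t < m) (g t == v) <= (b <= v < m + b))%N.
  move=> gE; apply: leq_trans (sum_eq_shift m b v); apply: leq_sum => t _.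
  by rewrite -val_eqE /= gE.
rewrite big_sumType /= -!big_distrr /= !big_split /=.
have h1 : (\sum_(t < (n.+1 - k).+1) (inord t == v :> 'I_n.+1)
    <= (0 <= v < (n.+1 - k).+1 + 0))%N.
  by apply: le_e => t; rewrite addn0 inordK //; have := ltn_ord t; lia.
have h2 : (\sum_(t < (n.+1 - k).+1) (inord (t + k.-1) == v :> 'I_n.+1)
    <= (k.-1 <= v < (n.+1 - k).+1 + k.-1))%N.
  by apply: le_e => t; rewrite inordK //; have := ltn_ord t; lia.
have h3 : (\sum_(t < n.+1 - k) (inord t == v :> 'I_n.+1)
    <= (0 <= v < n.+1 - k + 0))%N.
  by apply: le_e => t; rewrite addn0 inordK //; have := ltn_ord t; lia.
have h4 : (\sum_(t < n.+1 - k) (inord (t + k) == v :> 'I_n.+1)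
    <= (k <= v < n.+1 - k + k))%N.
  by apply: le_e => t; rewrite inordK //; have := ltn_ord t; lia.
move: h1 h2 h3 h4.
do 4![case: (\sum_(_ < _) _)%N => [|[|?]]]; have := ltn_ord v; lia.
Qed.

Lemma sum_emul_total : (\sum_z emul z = E + (n.+1 - k) * D)%N.
Proof.
rewrite big_sumType /= !sum_nat_const !card_ord mulSn -addnA -mulnDr.
by rewrite subnKC.
Qed.

Variable R : realType.

Let T := (E + (n.+1 - k) * D)%N.

(** The base point is the left end of a shortest window of [k] points. Each point outside that
    window is matched with one edge of either kind, whose lengths bound its distance to the base
    point up to a factor 2; the window itself supplies the factor of exponent [E]. *)
Lemma window_matching (phi : 'I_n.+1 -> R) :
  (forall i j : 'I_n.+1, (i <= j)%N -> phi i <= phi j) ->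
  exists i, Bsum D (E + (n.+1 - k) * D) (fun j => `|phi i - phi j|)
    <= (Bcard n.+1 D)%:R * 2 ^+ ((n.+1 - k) * D)
       * \prod_z `|phi (esrc z) - phi (etgt z)| ^+ emul z.
Proof.
move=> phi_mono; pose psi t := phi (inord t).
have psi_mono s t : (s <= t <= n)%N -> psi s <= psi t.
  by move=> h; apply: phi_mono; rewrite !inordK; lia.
have psiB s t : (s <= t <= n)%N -> `|psi s - psi t| = psi t - psi s.
  by move=> h; rewrite distrC ger0_norm // subr_ge0 psi_mono.
pose m := (n.+1 - k)%N; have mE : m = (n.+1 - k)%N by [].
pose L t := psi (t + k.-1)%N - psi t.
have [c _ c_min] := @arg_minP _ _ 'I_m.+1 ord0 xpredT (fun t => L t) isT.
have cm := ltn_ord c; rewrite ltnS in cm.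
have L_min t : (t <= m)%N -> L c <= L t.
  by move=> ht; have := c_min (inord t) isT; rewrite inordK.
have L0 : 0 <= L c by rewrite subr_ge0 psi_mono //; lia.
(* [o] enumerates the indices outside [[c, c + k)]. *)
pose o (t : 'I_m) : 'I_n.+1 := inord (if (t < c)%N then t : nat else (t + k)%N).
have oE t : o t = (if (t < c)%N then t : nat else (t + k)%N) :> nat.
  by rewrite inordK //; have := ltn_ord t; case: ifP; lia.
have o_inj : injective o.
  move=> s t /(congr1 val) /=; rewrite !oE => h; apply: val_inj => /=.
  by move: h; case: ifP; case: ifP; lia.
pose H := [set o t | t : 'I_m].
pose d j := `|phi (inord c) - phi j|; pose x j := Num.max (d j) (L c).
have phiE j : phi j = psi j by rewrite /psi inord_val.
(* Any two windows of [k] indices overlap because [n + 1 < 2 k]. Hence the way from [c] to [o t] is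
   covered by the matched edge and the window at [c], which is no longer than that edge. *)
have x_le t : x (o t) <= 2 * (psi (t + k)%N - psi t) /\
              x (o t) <= 2 * L (lift c t).
  have tm := ltn_ord t.
  rewrite !ge_max /d -/(psi c) !phiE oE /L /= /bump.
  have := L_min t; have := L_min t.+1; rewrite /L => L1 L2.
  have {}L1 := L1 tm; have {}L2 := L2 (ltnW tm).
  have [tc|tc] := ltnP t c.
    rewrite distrC psiB ?add0n; last by lia.
    have : psi c <= psi (t + k.-1)%N by apply: psi_mono; lia.
    have : psi (t + k.-1)%N <= psi (t + k)%N by apply: psi_mono; lia.
    have : psi t <= psi c by apply: psi_mono; lia.
    by move=> *; split; apply/andP; split; lra.
  rewrite psiB ?add1n; last by lia.
  have -> : (t.+1 + k.-1 = t + k)%N by lia.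
  rewrite (_ : t.+1 + k.-1 = t + k)%N in L1; last by lia.
  have : psi (t + k.-1)%N <= psi (t + k)%N by apply: psi_mono; lia.
  have : psi t <= psi (c + k.-1)%N by apply: psi_mono; lia.
  have : psi t.+1 <= psi (c + k.-1)%N by apply: psi_mono; lia.
  have : psi c <= psi t by apply: psi_mono; lia.
  by move=> *; split; apply/andP; split; lra.
exists (inord c).
have x0 j : 0 <= x j by rewrite le_max L0 orbT.
have d0 j : 0 <= d j by exact: normr_ge0.
apply: le_trans (_ : (Bcard n.+1 D)%:R
    * (L c ^+ E * \prod_(j in H) x j ^+ D) <= _).
  apply: Bsum_le => [|u hu].
    by rewrite mulr_ge0 ?exprn_ge0 // prodr_ge0 // => j _; rewrite exprn_ge0.
  apply: knapsack_le => // [j jH|j _|j|].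
  - suff hj : (c <= j < c + k)%N.
      rewrite -/(psi c) phiE psiB; last by have := ltn_ord j; lia.
      by rewrite lerD2r; apply: psi_mono; lia.
    apply: contraNT jH => hj.
    have hjn := ltn_ord j; apply/imsetP.
    have [jc|cj] := ltnP j c.
      have jm : (j < m)%N by lia.
      by exists (Ordinal jm) => //; apply: val_inj; rewrite /= oE /= jc.
    have jm : (j - k < m)%N by lia.
    exists (Ordinal jm) => //; apply: val_inj; rewrite /= oE /=.
    by case: ifP; lia.
  - by rewrite /x !le_max !lexx orbT.
  - by rewrite -ltnS.
  - by rewrite card_imset // card_ord.
rewrite -mulrA ler_wpM2l // big_imset /=; last by move=> s t _ _; exact: o_inj.
(* The left edge at [c] gives [L c ^ E]. The other left edges, at [lift c t], are paired with the
   right edges at [t], so that [x (o t) ^ D] splits into powers [E] and [D - E]. *)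
rewrite big_sumType /= (bigD1_ord c) //= mulrCA -mulrA.
have psi_src t : (t <= m)%N -> `|phi (inord t) - phi (inord (t + k.-1))| = L t.
  by move=> ht; apply: psiB; lia.
rewrite psi_src // ler_wpM2l ?exprn_ge0 //.
rewrite mulnC exprM -[m in _ ^+ m](card_ord m) -prodr_const -!big_split /=.
apply: ler_prod => t _; rewrite exprn_ge0 //=.
have [x2 x1] := x_le t; have tm := ltn_ord t.
rewrite psi_src; last by rewrite /= /bump; lia.
have -> : `|phi (inord t) - phi (inord (t + k))| = psi (t + k)%N - psi t.
  by apply: psiB; lia.
have expD (y : R) : y ^+ D = y ^+ E * y ^+ (D - E) by rewrite -exprD subnKC.
rewrite !expD -mulrA mulrA (mulrC (L _ ^+ E)) -!exprMn.
apply: ler_pM; rewrite ?exprn_ge0 // lerXn2r ?nnegrE //.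
- exact: le_trans x1.
- exact: le_trans x2.
Qed.

Definition edge_prod (s : 'S_n.+1) (e : 'I_n.+1 -> 'I_n.+1 -> R) : R :=
  \prod_z e (s (esrc z)) (s (etgt z)) ^+ emul z.

(** Each edge is at most twice the larger distance from [i] to its ends, so the multigraph bound
    applies at any base point [i]. *)
Lemma edge_prod_le_Bsum (s : 'S_n.+1) (e : 'I_n.+1 -> 'I_n.+1 -> R) i :
  (forall a b, 0 <= e a b) -> (forall a b, e a b <= e i a + e i b) ->
  edge_prod s e <= 2 ^+ T * Bsum D T (e i).
Proof.
move=> e0 etri.
apply: (multigraph_le_Bsum (s := s \o esrc) (t := s \o etgt)) => // [z|v|].
- rewrite e0 /=; apply: le_trans (etri _ _) _; rewrite mulr_natl mulr2n.
  by apply: lerD; rewrite le_max lexx ?orbT.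
- rewrite -[v](permKV s); under eq_bigr => z _ do rewrite /= !(inj_eq (@perm_inj _ s)).
  exact: sum_emul.
- exact: sum_emul_total.
Qed.

Lemma Bsum_le_edge_prod (phi : 'I_n.+1 -> R) :
  exists i s, Bsum D T (fun j => `|phi i - phi j|)
    <= (Bcard n.+1 D)%:R * 2 ^+ ((n.+1 - k) * D)
       * edge_prod s (fun a b => `|phi a - phi b|).
Proof.
have [s hs] := sorting_perm phi.
have [i hi] := window_matching hs.
by exists (s i), s; rewrite -(Bsum_perm _ _ _ s).
Qed.

End Windows.

(** * A projection to the line that preserves distances up to constants *)

Section Projection.
Variables (R : realType) (N : nat).

Lemma Re_le_cmod (z : R[i]) : `|complex.Re z| <= cmod z.
Proof. by rewrite -sqrtr_sqr ler_wsqrtr // lerDl sqr_ge0. Qed.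

Lemma Im_le_cmod (z : R[i]) : `|complex.Im z| <= cmod z.
Proof. by rewrite -sqrtr_sqr ler_wsqrtr // lerDr sqr_ge0. Qed.

Lemma cmod_le_ReIm (z : R[i]) : cmod z <= `|complex.Re z| + `|complex.Im z|.
Proof.
rewrite -[leRHS]ger0_norm ?addr_ge0 // -sqrtr_sqr ler_wsqrtr // sqrrD.
by rewrite !real_normK ?num_real // addrAC lerDl mulrn_wge0 // mulr_ge0.
Qed.

(** Chaining the bounds, [c <= x + (m + 1) * v <= (m + 2) * x + (m + 1) * y], and the two
    coefficients add up to [3 + 2 * m]. *)
Let two_small_projections (m t c u v x y : R) : 0 <= m -> 0 <= v ->
  (3 + 2 * m) * x < c -> (3 + 2 * m) * y < c -> v <= y + x ->
  u <= x + t * v -> c <= u + v -> v * t <= v * m -> False.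
Proof.
move=> m0 v0 hx hy hv hu hc htm.
have p1 : 0 <= (3 + 2 * m) * (y + x - v) by rewrite mulr_ge0; lra.
have p2 : 0 < (m + 1) * (2 * c - (3 + 2 * m) * v) by rewrite mulr_gt0; lra.
have p3 : 0 <= (3 + 2 * m) * (x + v * m + v - c) by rewrite mulr_ge0; lra.
lra.
Qed.

(* A pair of points can be nearly collapsed by [Re + t Im] for at most one of
   the integers [t <= N ^ 2], so some [t] collapses no pair. *)
Lemma real_projection (al : 'I_N -> R[i]) :
  exists phi : 'I_N -> R, forall a b,
    cmod (al a - al b) <= (3 + 2 * N ^ 2)%:R * `|phi a - phi b| /\
    `|phi a - phi b| <= (1 + N ^ 2)%:R * cmod (al a - al b).
Proof.
pose M := (N ^ 2)%N; pose C : R := (3 + 2 * M)%:R.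
pose l (t : nat) (z : R[i]) := complex.Re z + t%:R * complex.Im z.
have lB t z w : l t z - l t w = l t (z - w).
  by case: z w => [zr zi] [wr wi]; rewrite /l /=; ring.
pose bad (t : 'I_M.+1) (p : 'I_N * 'I_N) :=
  C * `|l t (al p.1 - al p.2)| < cmod (al p.1 - al p.2).
have [[t ht]|allbad] := pselect (exists t, forall p, ~~ bad t p); last first.
  exfalso.
  have ex_p t : exists p, bad t p.
    apply: contrapT => h; apply: allbad; exists t => p.
    by apply/negP => hp; apply: h; exists p.
  pose g t := projT1 (cid (ex_p t)).
  have hg t : bad t (g t) by exact: projT2 (cid (ex_p t)).
  (* Two values [s], [t] bad for the same pair would make [(s - t) * Im z] small, hence [Im z],
     hence [Re z], hence [z] smaller than itself. This leaves [N ^ 2 + 1] values for [N ^ 2]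
     pairs. *)
  have g_inj : injective g.
    move=> s t gst; apply/eqP; apply: contraT => st; exfalso.
    have := hg s; have := hg t; rewrite -gst /bad.
    set z := al _ - al _; rewrite /l => bt bs.
    have Cpos : 0 < C by rewrite ltr0n.
    have M1 : (M%:R : R) >= 0 by [].
    have CE : C = 3 + 2 * M%:R by rewrite /C natrD natrM.
    have dv : `|complex.Im z| <= `|(s%:R - t%:R) * complex.Im z| :> R.
      rewrite normrM ler_peMl //.
      move: st; rewrite -val_eqE /= neq_ltn => /orP[] h.
        by rewrite distrC -natrB ?(ltnW h) // normr_nat ler1n subn_gt0.
      by rewrite -natrB ?(ltnW h) // normr_nat ler1n subn_gt0.
    have tM : t%:R <= (M%:R : R) by rewrite ler_nat -ltnS.
    have tM0 : 0 <= (t%:R : R) by [].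
    have b1 : `|(s%:R - t%:R) * complex.Im z| <=
        `|complex.Re z + s%:R * complex.Im z| + `|complex.Re z + t%:R * complex.Im z|.
      apply: le_trans (ler_normB _ _); rewrite le_eqVlt; apply/orP; left.
      by apply/eqP; congr (`|_|); ring.
    have b2 : `|complex.Re z| <=
        `|complex.Re z + t%:R * complex.Im z| + t%:R * `|complex.Im z|.
      rewrite -{2}(ger0_norm tM0) -normrM; apply: le_trans (ler_normB _ _).
      by rewrite addrK.
    have b3 := cmod_le_ReIm z.
    have b4 : `|complex.Im z| * t%:R <= `|complex.Im z| * M%:R.
      by rewrite ler_wpM2l.
    move: bt bs dv b1 b2 b3 b4; rewrite CE.
    move=> h1 h2 h3 h4 h5 h6 h7.
    exact: two_small_projections M1 (normr_ge0 _) h1 h2 (le_trans h3 h4) h5 h6 h7.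
  have := leq_card g g_inj.
  by rewrite card_ord card_prod !card_ord -[(N * N)%N]/(N ^ 2)%N ltnn.
exists (fun a => l t (al a)) => a b; rewrite lB; split.
  by have := ht (a, b); rewrite /bad -leNgt.
rewrite /l natrD mulrDl mul1r; apply: le_trans (ler_normD _ _) _.
apply: lerD; first exact: Re_le_cmod.
rewrite normrM normr_nat; apply: ler_pM => //; last exact: Im_le_cmod.
by rewrite ler_nat -ltnS.
Qed.

End Projection.

(** * Integrals over the plane and a dyadic majorant *)

Section PlaneIntegrals.
Variable R : realType.
Local Open Scope classical_set_scope.

Local Notation mu2 := ((@lebesgue_measure R) \x (@lebesgue_measure R))%E.

(** The integral of a nonnegative function is a supremum over the simple functions below it, so it
    grows with the function, measurable or not. *)
Lemma le_integral_setT d (T : measurableType d) (mu : {measure set T -> \bar R})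
    (D : set T) (f g : T -> \bar R) :
  (forall x, D x -> (0 <= f x)%E) -> (forall x, (0 <= g x)%E) ->
  (forall x, D x -> (f x <= g x)%E) ->
  (\int[mu]_(x in D) f x <= \int[mu]_x g x)%E.
Proof.
move=> f0 g0 fg; rewrite ge0_integralE // ge0_integralTE //.
apply: ereal_sup_le => _ [h /= hf <-]; exists h => //= x.
apply: le_trans (hf x) _; rewrite patchE; case: ifPn => // xD.
by apply: fg; rewrite inE in xD.
Qed.

Definition sq (c : R * R) (r : R) : set (R * R) :=
  `[c.1 - r, c.1 + r]%classic `*` `[c.2 - r, c.2 + r]%classic.

Lemma measurable_sq c r : measurable (sq c r : set (measurableTypeR R * measurableTypeR R)).
Proof. by apply: measurableX; exact: measurable_itv. Qed.

Lemma measure_sq c r : 0 < r -> mu2 (sq c r) = (4 * r ^+ 2)%:E.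
Proof.
move=> r0; have side (t : R) : lebesgue_measure `[t - r, t + r]%classic = (2 * r)%:E.
  rewrite lebesgue_measure_itv /= lte_fin ifT; last by lra.
  by rewrite EFinN -EFinB; congr EFin; lra.
rewrite product_measure1E; [|exact: measurable_itv..].
have -> : (4 * r ^+ 2)%:E = ((2 * r)%:E * (2 * r)%:E)%E.
  by rewrite -EFinM; congr EFin; ring.
by congr (_ * _)%E; exact: side.
Qed.

Lemma powRE_expR (x y : R) : 0 < x -> x `^ y = expR (y * ln x).
Proof. by move=> x0; rewrite /powR gt_eqF. Qed.

Lemma powR_antitone (x y e : R) : 0 < x -> x <= y -> 0 <= e ->
  y `^ (- e) <= x `^ (- e).
Proof.
move=> x0 xy e0; have y0 := lt_le_trans x0 xy.
rewrite !powRE_expR // ler_expR !mulNr lerN2 ler_wpM2l //.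
by rewrite ler_ln.
Qed.

Lemma dyadic_bracket (t : R) : 1 <= t ->
  exists n : nat, 2 `^ n%:R <= t /\ t <= 2 `^ n.+1%:R.
Proof.
move=> t1; have t0 : 0 < t by exact: lt_le_trans t1.
have l2 : 0 < ln (2 : R) by rewrite ln_gt0 // ltr1n.
have z0 : 0 <= ln t / ln 2 by apply: divr_ge0; [exact: ln_ge0 | exact: ltW].
have /andP[h1 h2] := truncn_itv z0.
exists (Num.truncn (ln t / ln 2)); rewrite !powRE_expR //.
rewrite -{2 3}(@lnK _ t) // !ler_expR -ler_pdivlMr // h1; split => //.
by rewrite -ler_pdivrMr // ltW.
Qed.

Section Majorant.
Variables (a b : R).
Hypotheses (a0 : 0 <= a) (a2 : a < 2) (ab2 : 2 < a + b).
Variables (c : R * R) (d : R).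
Hypothesis d0 : 0 < d.

(** A step function above [|z - c| ^ (-a) * max(|z - c|, d) ^ (-b)]: [r1] runs through the dyadic
    scales below [d], [r2] through those above. The heights [e1 n] and [e2 n] are the values at the
    inner radius of the shell, [r1 n.+1] or [r2 n], and each is spread over the whole outer
    square. *)
Let r1 (n : nat) : R := d * 2 `^ (- n%:R).
Let r2 (n : nat) : R := d * 2 `^ (n%:R).
Let e1 (n : nat) : R := (r1 n.+1) `^ (- a) * d `^ (- b).
Let e2 (n : nat) : R := (r2 n) `^ (- (a + b)).
Let term (n : nat) (p : measurableTypeR R * measurableTypeR R) : R :=
  e1 n * \1_(sq c (r1 n)) p + e2 n * \1_(sq c (r2 n.+1)) p.

Definition majorant (p : measurableTypeR R * measurableTypeR R) : \bar R :=
  (\sum_(0 <= n <oo) (term n p)%:E)%E.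

(** Sums of two geometric series of ratios [2 ^ (a - 2)] and [2 ^ (2 - a - b)], from the small and
    the large squares; they converge since [a < 2 < a + b]. *)
Definition majorant_const : R :=
  4 * 2 `^ a / (1 - 2 `^ (a - 2)) + 16 / (1 - 2 `^ (2 - a - b)).

Let r1_gt0 n : 0 < r1 n. Proof. by rewrite mulr_gt0 ?powR_gt0. Qed.
Let r2_gt0 n : 0 < r2 n. Proof. by rewrite mulr_gt0 ?powR_gt0. Qed.
Let e1_ge0 n : 0 <= e1 n. Proof. by rewrite mulr_ge0 ?powR_ge0. Qed.
Let e2_ge0 n : 0 <= e2 n. Proof. exact: powR_ge0. Qed.
Let term_ge0 n p : 0 <= term n p.
Proof. by rewrite addr_ge0 // mulr_ge0 // indicE. Qed.

Lemma majorant_ge0 p : (0 <= majorant p)%E.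
Proof. by apply: nneseries_ge0 => n _ _; rewrite lee_fin. Qed.

Let measurable_term n :
  measurable_fun setT (EFin \o term n).
Proof.
apply/measurable_EFinP; apply: measurable_funD; apply: measurable_funM => //;
  by apply: measurable_indic; exact: measurable_sq.
Qed.

Lemma measurable_majorant : measurable_fun setT majorant.
Proof.
apply: (@ge0_emeasurable_sum _ _ _ setT (fun n p => (term n p)%:E) xpredT).
  by move=> n p _ _; rewrite lee_fin.
by move=> n _; exact: measurable_term.
Qed.

Lemma majorant_ge_term n p : ((term n p)%:E <= majorant p)%E.
Proof.
apply: le_trans (nneseries_lim_ge n.+1 _); last by move=> m _ _; rewrite lee_fin.
rewrite big_nat_recr //= leeDr // sume_ge0 // => m _; exact: term_ge0.
Qed.

Lemma integral_majorant :
  (\int[mu2]_p majorant p <= (majorant_const * d `^ (2 - a - b))%:E)%E.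
Proof.
rewrite integral_nneseries //; last by move=> n p _; rewrite lee_fin.
pose x : R := 2 `^ (a - 2); pose y : R := 2 `^ (2 - a - b).
have l2 : 0 < ln (2 : R) by rewrite ln_gt0 // ltr1n.
have x1 : `|x| < 1.
  rewrite ger0_norm ?powR_ge0 // /x powRE_expR // expR_lt1 pmulr_llt0 //.
  by rewrite subr_lt0.
have y1 : `|y| < 1.
  rewrite ger0_norm ?powR_ge0 // /y powRE_expR // expR_lt1 pmulr_llt0 //.
  by rewrite -addrA -opprD subr_lt0.
have r1E n : r1 n = expR (ln d - n%:R * ln 2).
  by rewrite /r1 powRE_expR // expRD lnK ?posrE // mulNr.
have r2E n : r2 n = expR (ln d + n%:R * ln 2).
  by rewrite /r2 powRE_expR // expRD lnK ?posrE.
have E n : (\int[mu2]_p (term n p)%:E)%E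
   = (d `^ (2 - a - b) * (geometric (4 * 2 `^ a) x n + geometric 16 y n))%:E.
  have m_ind r : measurable_fun setT
      (fun p : measurableTypeR R * measurableTypeR R => (\1_(sq c r) p : R)%:E).
    by apply/measurable_EFinP; apply: measurable_indic; exact: measurable_sq.
  have ind0 r (p : measurableTypeR R * measurableTypeR R) :
      (0 <= (\1_(sq c r) p : R)%:E)%E by rewrite lee_fin indicE.
  have int_ind (e r : R) : 0 <= e -> 0 < r ->
      (\int[mu2]_p (e%:E * (\1_(sq c r) p)%:E) = (e * (4 * r ^+ 2))%:E)%E.
    move=> e_ge0 r_gt0; rewrite ge0_integralZl // ?lee_fin //.
    rewrite integral_indic //; last exact: measurable_sq.
    by rewrite setIT EFinM; congr (_ * _)%E; exact: measure_sq.
  transitivity (\int[mu2]_p ((e1 n)%:E * (\1_(sq c (r1 n)) p)%:E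
    + (e2 n)%:E * (\1_(sq c (r2 n.+1)) p)%:E))%E; first exact: eq_integral.
  rewrite ge0_integralD //.
  - rewrite !int_ind // -EFinD; congr EFin.
    (* With all powers written as exponentials, both summands reduce to identities between
       exponents. *)
    rewrite mulrDr /geometric /=; congr (_ + _).
    + rewrite /e1 !r1E -expRM_natl powRE_expR ?expR_gt0 // expRK !(powRE_expR _ d0).
      rewrite /x !powRE_expR // -expRM_natl.
      transitivity (4 * (expR (- a * (ln d - n.+1%:R * ln 2))
        * expR (- b * ln d) * expR (2 * (ln d - n%:R * ln 2)))); first by ring.
      transitivity (4 * (expR ((2 - a - b) * ln d) * expR (a * ln 2)
        * expR (n%:R * ((a - 2) * ln 2)))); last by ring.
      by rewrite -!expRD -natr1; congr (_ * expR _); ring.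
    + rewrite /e2 !r2E -expRM_natl powRE_expR ?expR_gt0 // expRK !(powRE_expR _ d0).
      rewrite /y !powRE_expR // -expRM_natl.
      have -> : 16 = 4 * expR (2 * ln 2) :> R.
        by rewrite expRM_natl lnK ?posrE // -natrX -natrM.
      transitivity (4 * (expR (- (a + b) * (ln d + n%:R * ln 2))
        * expR (2 * (ln d + n.+1%:R * ln 2)))); first by ring.
      transitivity (4 * (expR ((2 - a - b) * ln d) * expR (2 * ln 2)
        * expR (n%:R * ((2 - a - b) * ln 2)))); last by ring.
      by rewrite -!expRD -natr1; congr (_ * expR _); ring.
  - by move=> p _; rewrite mule_ge0 // lee_fin.
  - exact: measurable_funeM.
  - by move=> p _; rewrite mule_ge0 // lee_fin.
  - exact: measurable_funeM.
under eq_eseriesr => n _ do rewrite E.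
have g0 n : 0 <= geometric (4 * 2 `^ a) x n + geometric 16 y n.
  by rewrite addr_ge0 // geometric_ge0 ?mulr_ge0 ?powR_ge0.
apply: lime_le.
  by apply: is_cvg_nneseries => n _ _; rewrite lee_fin mulr_ge0 ?powR_ge0.
apply: nearW => n; rewrite sumEFin lee_fin -mulr_sumr mulrC.
rewrite ler_wpM2r ?powR_ge0 // big_split /=; apply: lerD.
  by apply: geometric_le_lim; rewrite ?mulr_ge0 ?powR_ge0 ?powR_gt0.
by apply: geometric_le_lim; rewrite ?mulr_ge0 ?powR_ge0 ?powR_gt0.
Qed.

(** At the centre every term is at least the same positive [K], even for [a = 0]. So the majorant
    also dominates an integrand that is infinite there. *)
Lemma majorant_center : majorant c = +oo%E.
Proof.
apply/eqyP => A A0.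
pose K := d `^ (- a) * d `^ (- b).
have K0 : 0 < K by rewrite mulr_gt0 ?powR_gt0.
have term_c n : K <= term n c.
  have c_in r : 0 < r -> \1_(sq c r) c = 1 :> R.
    by move=> r0; rewrite indicE mem_set //; split => /=; rewrite in_itv /=; lra.
  rewrite /term !c_in // !mulr1 -[K]addr0; apply: lerD => //.
  rewrite /K /e1 ler_wpM2r ?powR_ge0 // powR_antitone //.
  rewrite /r1 ler_piMr ?(ltW d0) // powRN invf_le1 ?powR_gt0 //.
  by rewrite powR_mulrn // exprn_ege1 // ler1n.
pose m := (Num.truncn (A / K)).+1.
apply: le_trans (nneseries_lim_ge m _); last by move=> n _ _; rewrite lee_fin.
rewrite sumEFin lee_fin.
apply: le_trans (_ : \sum_(0 <= n < m) K <= _); last by apply: ler_sum.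
rewrite sumr_const_nat subn0 -mulr_natr mulrC -ler_pdivrMr // ltW //.
by have /andP[_] := truncn_itv (divr_ge0 (ltW A0) (ltW K0)).
Qed.

Lemma majorant_ge (p : R * R) : p != c ->
  ((cmod (cpt p - cpt c) `^ (- a)
    * Num.max (cmod (cpt p - cpt c)) d `^ (- b))%:E <= majorant p)%E.
Proof.
move=> pc; set rho := cmod _.
have b0 : 0 <= b by rewrite -(lerD2l a) addr0 ltW // (lt_trans a2).
(* The sup-norm distance [t] decides in which squares [p] lies; [t <= rho] carries the bound over to
   the modulus. *)
pose t : R := Num.max `|p.1 - c.1| `|p.2 - c.2|.
have t_rho : t <= rho.
  rewrite ge_max; have := Re_le_cmod (cpt p - cpt c).
  by have := Im_le_cmod (cpt p - cpt c); rewrite /= => -> ->.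
have t0 : 0 < t.
  rewrite lt_max !normr_gt0 !subr_eq0 -negb_and; apply: contra pc.
  by rewrite -xpair_eqE -!surjective_pairing.
have rho0 : 0 < rho by exact: lt_le_trans t_rho.
have p_in (r : R) : t <= r -> \1_(sq c r) p = 1 :> R.
  by rewrite ge_max !ler_distl => /andP[h1 h2]; rewrite indicE mem_set.
have /orP[td|dt] := le_total t d.
  have d_t : 1 <= d / t by rewrite ler_pdivlMr ?mul1r.
  have [n [n1 n2]] := dyadic_bracket d_t.
  apply: le_trans (majorant_ge_term n p); rewrite lee_fin /term p_in; last first.
    by rewrite /r1 powRN -ler_pdivrMr ?invr_gt0 ?powR_gt0 // invrK mulrC -ler_pdivlMr.
  rewrite mulr1 -[X in X <= _]addr0; apply: lerD; last by rewrite mulr_ge0 // indicE.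
  rewrite /e1; apply: ler_pM; rewrite ?powR_ge0 //; apply: powR_antitone => //.
    apply: le_trans t_rho; rewrite /r1 powRN ler_pdivrMr ?powR_gt0 // mulrC.
    by rewrite -ler_pdivrMr.
  by rewrite le_max lexx orbT.
have t_d : 1 <= t / d by rewrite ler_pdivlMr ?mul1r.
have [n [n1 n2]] := dyadic_bracket t_d.
apply: le_trans (majorant_ge_term n p); rewrite lee_fin /term.
rewrite (p_in (r2 n.+1)); last by rewrite /r2 mulrC -ler_pdivrMr.
rewrite mulr1 -[X in X <= _]add0r; apply: lerD; first by rewrite mulr_ge0 // indicE.
rewrite max_l; last exact: le_trans dt t_rho.
rewrite -powRD; last by rewrite (gt_eqF rho0) implybT.
rewrite -opprD; apply: powR_antitone; rewrite ?addr_ge0 //.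
by apply: le_trans t_rho; rewrite /r2 mulrC -ler_pdivlMr.
Qed.

End Majorant.
End PlaneIntegrals.

(** * General upper and lower bounds for the integral *)

Section IntegralBounds.
Variable R : realType.
Local Open Scope classical_set_scope.

Local Notation mu2 := ((@lebesgue_measure R) \x (@lebesgue_measure R))%E.

Lemma integrand_ge0 N (A : 'I_N -> R[i]) delta p : (0 <= integrand A delta p)%E.
Proof. by rewrite /integrand; case: ifP => // _; rewrite lee_fin powR_ge0. Qed.

(** Each point of the disk is charged to one centre, so the weighted sum of the majorants at all
    centres dominates the integrand. *)
Lemma intQ_upper N (A : 'I_N -> R[i]) (Lambda delta a b : R)
    (n : nat) (c : 'I_n -> R[i]) (kap d : 'I_n -> R) :
  0 <= a -> a < 2 -> 2 < a + b ->
  (forall i, 0 < kap i) -> (forall i, 0 < d i) ->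
  (forall p, disk Lambda p -> exists i, cpt p = c i \/
     (Qpoly A (cpt p) != 0 /\ cmod (Qpoly A (cpt p)) `^ (- delta)
       <= kap i * (cmod (cpt p - c i) `^ (- a)
                   * Num.max (cmod (cpt p - c i)) (d i) `^ (- b)))) ->
  (intQ A Lambda delta
    <= (majorant_const a b * \sum_i kap i * d i `^ (2 - a - b))%:E)%E.
Proof.
move=> a0 a2 ab2 kap0 d0 hp.
pose cc i : R * R := (complex.Re (c i), complex.Im (c i)).
have ccE i : cpt (cc i) = c i by rewrite /cpt /cc /=; case: (c i).
pose g i p := ((kap i)%:E * majorant a b (cc i) (d i) p)%E.
have g0 i p : (0 <= g i p)%E.
  by rewrite mule_ge0 ?majorant_ge0 // lee_fin ltW.
have mg i : measurable_fun setT (g i).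
  by apply: measurable_funeM; exact: measurable_majorant.
apply: le_trans (_ : (\int[mu2]_p (\sum_(i < n) g i p) <= _)%E).
  apply: le_integral_setT => [p _|p|p Dp].
  - exact: integrand_ge0.
  - exact: sume_ge0.
  have [i hi] := hp p Dp.
  have gi : (g i p <= \sum_(i < n) g i p)%E.
    by rewrite (bigD1 i) //= leeDl // sume_ge0.
  apply: le_trans gi; rewrite /g.
  have [pc|pc] := eqVneq p (cc i).
    by rewrite pc majorant_center // gt0_muley ?lte_fin ?kap0 // leey.
  case: hi => [pci|[Q0 Qle]].
    by case/eqP: pc; rewrite /cc -pci; case: (p).
  rewrite /integrand (negbTE Q0).
  apply: le_trans (_ : (kap i)%:E * (cmod (cpt p - c i) `^ (- a)
    * Num.max (cmod (cpt p - c i)) (d i) `^ (- b))%:E <= _)%E.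
    by rewrite -EFinM lee_fin.
  apply: lee_wpmul2l; first by rewrite lee_fin ltW.
  by rewrite -(ccE i); exact: majorant_ge.
rewrite ge0_integral_sum // mulr_sumr -sumEFin; apply: lee_sum => i _.
rewrite ge0_integralZl //; first last.
- by rewrite lee_fin ltW.
- by move=> p _; exact: majorant_ge0.
- exact: measurable_majorant.
rewrite mulrCA EFinM; apply: lee_wpmul2l; first by rewrite lee_fin ltW.
exact: integral_majorant.
Qed.

Lemma cmod_cpt (p : R * R) : cmod (cpt p) ^+ 2 = p.1 ^+ 2 + p.2 ^+ 2.
Proof. by rewrite /cmod sqr_sqrtr //= addr_ge0 ?sqr_ge0. Qed.

Lemma diskP (r : R) (p : R * R) : 0 < r -> disk r p <-> cmod (cpt p) < r.
Proof.
move=> r0; rewrite /disk /= -cmod_cpt ltr_pXn2r ?nnegrE ?cmod_ge0 //.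
exact: ltW.
Qed.

(** The square of half side [rho / 4] at [c] has area [rho ^ 2 / 4], lies within [rho / 2] of [c],
    hence in the disk of radius [Lambda], and there the integrand is at least [X ^ (-delta)]. *)
Lemma intQ_lower N (A : 'I_N -> R[i]) (Lambda delta rho X : R) (c : R[i]) :
  0 <= delta -> cmod c < Lambda / 2 -> 0 < rho -> rho <= Lambda -> 0 < X ->
  (forall z, cmod (z - c) <= rho / 2 -> cmod (Qpoly A z) <= X) ->
  ((X `^ (- delta) * (rho ^+ 2 / 4))%:E <= intQ A Lambda delta)%E.
Proof.
move=> delta0 cL rho0 rhoL X0 hQ.
pose cc : R * R := (complex.Re c, complex.Im c).
have ccE : cpt cc = c by rewrite /cpt /cc /=; case: (c).
rewrite /intQ integral_mkcond.
have r4 : 0 < rho / 4 by rewrite divr_gt0.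
have -> : (X `^ (- delta) * (rho ^+ 2 / 4))%:E
  = (\int[mu2]_(p in sq cc (rho / 4)) (cst (X `^ (- delta))%:E p))%E.
  rewrite integral_cst; last exact: measurable_sq.
  rewrite EFinM; congr (_ * _)%E; rewrite [RHS]measure_sq //.
  by congr EFin; field.
apply: le_integral_setT => [p _|p|p Sp] /=.
- by rewrite lee_fin powR_ge0.
- by rewrite patchE; case: ifP => // _; exact: integrand_ge0.
have pc : cmod (cpt p - c) <= rho / 2.
  case: Sp; rewrite /= !in_itv /= -!ler_distl => h1 h2.
  apply: le_trans (cmod_le_ReIm _) _; rewrite -ccE /=; lra.
have Dp : disk Lambda p.
  apply/diskP; first exact: lt_le_trans rhoL.
  have := cmodD (cpt p - c) c; rewrite subrK => h.
  apply: le_lt_trans h _; lra.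
rewrite patchE mem_set // /integrand; case: ifPn => [_|Q0]; first exact: leey.
by rewrite lee_fin powR_antitone ?cmod_gt0 ?hQ.
Qed.

Lemma Qpoly_roots N (A : 'I_N -> R[i]) :
  exists2 al, vieta A al & forall z, Qpoly A z = \prod_j (z - al j).
Proof.
pose s : {poly R[i]} := \sum_(i < N) A i *: 'X^(N - i.+1).
pose p := 'X^N + s.
have ss : (size s <= N)%N.
  apply: leq_trans (size_sum _ _ _) _; apply/bigmax_leqP => i _.
  apply: leq_trans (size_scale_leq _ _) _; rewrite size_polyXn.
  by have := ltn_ord i; lia.
have sp : size p = N.+1 by rewrite size_polyDl size_polyXn.
have lp : lead_coef p = 1 by rewrite lead_coefDl ?size_polyXn // lead_coefXn.
have [r] := closed_field_poly_normal p; rewrite lp scale1r => pE.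
have sr : size r == N.
  by have := sp; rewrite pE size_prod_XsubC => /eqP; rewrite eqSS.
have pE' : p = \prod_j ('X - (tnth (Tuple sr) j)%:P).
  by rewrite pE -[r]/(tval (Tuple sr)) big_tuple.
exists (tnth (Tuple sr)) => [i|z].
  rewrite -pE' /p coefD coefXn coef_sum (bigD1 i) //= big1 => [|j ji].
    rewrite coefZ coefXn eqxx mulr1 addr0.
    by have := ltn_ord i; case: eqP => [|_ _]; [lia | rewrite add0r].
  rewrite coefZ coefXn; case: eqP => [h|]; last by rewrite mulr0.
  case/eqP: ji; apply: val_inj => /=.
  by move: h; have := ltn_ord i; have := ltn_ord j; lia.
have -> : Qpoly A z = p.[z].
  rewrite /Qpoly /p hornerD hornerXn horner_sum; congr (_ + _).
  by apply: eq_bigr => i _; rewrite hornerZ hornerXn.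
rewrite pE' horner_prod; apply: eq_bigr => j _; by rewrite hornerXsubC.
Qed.

End IntegralBounds.

(** * The integral in terms of the distances between roots *)

Section RootDistances.
Variables (R : realType) (N k D E q : nat) (Lambda : R).
Hypotheses (k_gt0 : (0 < k)%N) (k_le : (k <= N)%N) (q_gt0 : (0 < q)%N).
Hypotheses (E_gt0 : (0 < E)%N) (E_lt : (E < D)%N) (kD : (k * D = 2 * q + E)%N).
Hypothesis Lambda_gt0 : 0 < Lambda.

Let delta : R := D%:R / q%:R.
(** The excess of [k * delta] over 2, with [0 < s < delta]. *)
Let s : R := E%:R / q%:R.
Let T := (E + (N - k) * D)%N.

Let q0 : (0 : R) < q%:R. Proof. by rewrite ltr0n. Qed.
Let delta_gt0 : 0 < delta.
Proof. by rewrite divr_gt0 // ltr0n; lia. Qed.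
Let s_gt0 : 0 < s. Proof. by rewrite divr_gt0 // ltr0n. Qed.

Let kdelta : k%:R * delta = 2 + s.
Proof.
rewrite /delta /s mulrA -natrM kD natrD natrM mulrDl mulfK //.
by rewrite pnatr_eq0 -lt0n.
Qed.

Let s_lt : s < delta.
Proof. by rewrite ltr_pM2r ?invr_gt0 // ltr_nat. Qed.

Section Points.
Variables (A al : 'I_N -> R[i]).
Hypothesis QE : forall z, Qpoly A z = \prod_j (z - al j).
Hypothesis al_lt : forall j, cmod (al j) < Lambda / 2.

Definition rootdist (i j : 'I_N) : R := cmod (al i - al j).
Definition Bval (i : 'I_N) : R := Bsum D T (rootdist i).

Let dist0 i j : 0 <= rootdist i j. Proof. exact: cmod_ge0. Qed.

Let dist_lt i j : rootdist i j < Lambda.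
Proof.
apply: le_lt_trans (cmodD _ _) _; rewrite cmodN.
by have := al_lt i; have := al_lt j; lra.
Qed.

Lemma Bval_ge0 i : 0 <= Bval i.
Proof. exact: Bsum_ge0. Qed.

Let cmodQ z : cmod (Qpoly A z) = \prod_j cmod (z - al j).
Proof. by rewrite QE cmod_prod. Qed.

Let card_notin (H : {set 'I_N}) : #|H| = (N - k)%N -> #|[predC H]| = k.
Proof. by move=> cH; have := cardC H; rewrite cH card_ord; lia. Qed.

Let prod_const_notin (H : {set 'I_N}) (x : R) : #|H| = (N - k)%N ->
  \prod_(j | j \notin H) x = x ^+ k.
Proof.
move=> cH; rewrite -(card_notin cH) -prodr_const.
by apply: eq_bigl => j; rewrite inE.
Qed.

Let prod_split (H : {set 'I_N}) (F : 'I_N -> R) :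
  \prod_j F j = (\prod_(j in H) F j) * \prod_(j | j \notin H) F j.
Proof. by rewrite (bigID (fun j => j \in H)). Qed.

(* The normal form of [B_i ^ (-1/q)] when [r] is the [k]-th smallest distance
   and [P] the product of the larger ones. *)
Let powR_normal (r P : R) : 0 < r -> 0 < P ->
  (r ^+ E * P ^+ D) `^ (- q%:R^-1) = r `^ (- s) * P `^ (- delta).
Proof.
move=> r0 P0; rewrite powRM ?exprn_ge0 ?(ltW r0) ?(ltW P0) //.
by rewrite -!powR_mulrn ?(ltW r0) ?(ltW P0) // -!powRrM !mulrN.
Qed.

(** Within [rho / 2] of [al i], a factor of [Q] is at most [2 * rho] outside [H] and [2 * x j] in
    [H]. The radius stays free: it is the [k]-th smallest distance if that is positive, and
    arbitrarily small if [k] roots coincide. *)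
Let lower_gen i (H : {set 'I_N}) (rho : R) (x : 'I_N -> R) :
  #|H| = (N - k)%N -> 0 < rho -> rho <= Lambda ->
  (forall j, j \notin H -> rootdist i j <= rho) ->
  (forall j, j \in H -> rootdist i j <= x j /\ rho <= x j) ->
  (((2 ^+ N * (rho ^+ k * \prod_(j in H) x j)) `^ (- delta)
     * (rho ^+ 2 / 4))%:E <= intQ A Lambda delta)%E.
Proof.
move=> cH rho0 rhoL dn dH.
have x0 j : j \in H -> 0 < x j by move=> /dH[_]; exact: lt_le_trans.
apply: (intQ_lower (c := al i)) => // [||z hz]; first exact: ltW.
  rewrite !mulr_gt0 ?exprn_gt0 //; exact: prodr_gt0.
rewrite cmodQ (prod_split H) mulrC.
have tri j : cmod (z - al j) <= rho / 2 + rootdist i j.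
  by apply: le_trans (cmodB_triangle z (al i) _) _; rewrite lerD2r.
apply: le_trans (_ : (\prod_(j | j \notin H) (2 * rho))
    * \prod_(j in H) (2 * x j) <= _).
  apply: ler_pM; try by apply: prodr_ge0 => j _; exact: cmod_ge0.
    apply: ler_prod => j /dn hj; rewrite cmod_ge0 /=.
    apply: le_trans (tri j) _; lra.
  apply: ler_prod => j /dH[h1 h2]; rewrite cmod_ge0 /=.
  apply: le_trans (tri j) _; lra.
rewrite prod_const_notin // big_split /= prodr_const cH exprMn.
have -> : 2 ^+ N = 2 ^+ k * 2 ^+ (N - k) :> R by rewrite -exprD subnKC.
by rewrite le_eqVlt; apply/orP; left; apply/eqP; ring.
Qed.

Definition low_const : R := (2 ^+ N) `^ (- delta) / 4.

(** At the scale [r] of the [k]-th smallest distance the lower bound is a multiple of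
    [r ^ (2 - k * delta) * P ^ (-delta)], and [2 - k * delta = -s] gives the normal form of
    [B_i ^ (-1/q)]. *)
Lemma intQ_ge_Bval i : 0 < Bval i ->
  ((low_const * Bval i `^ (- q%:R^-1))%:E <= intQ A Lambda delta)%E.
Proof.
move=> B0; have hk : (0 < k <= N)%N by rewrite k_gt0.
have [H [j0 [cH j0H dn dH]]] := kth_split (rootdist i) hk.
set r := rootdist i j0 in dn dH.
pose P := \prod_(j in H) rootdist i j.
have Bup : Bval i <= (Bcard N D)%:R * (r ^+ E * P ^+ D).
  rewrite /P -prodrXl; apply: Bsum_le => [|u hu].
    apply: mulr_ge0; first by apply: exprn_ge0; exact: dist0.
    by apply: prodr_ge0 => j _; rewrite exprn_ge0.
  apply: knapsack_le; [exact: dist0 | exact: dist0 | exact: dn | | | ].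
  - by move=> j hj; split => //; exact: dH.
  - by move=> j; rewrite -ltnS.
  - by rewrite hu /T cH.
have r0 : 0 < r.
  rewrite lt_def dist0 andbT; apply: contraTN B0 => /eqP r0.
  rewrite -leNgt; apply: le_trans Bup _.
  by rewrite r0 expr0n gtn_eqF // mul0r mulr0.
have P0 : 0 < P by apply: prodr_gt0 => j /dH; exact: lt_le_trans.
have Blow : r ^+ E * P ^+ D <= Bval i.
  by rewrite /P -prodrXl; apply: Bsum_lower => //; [exact: ltnW | rewrite cH].
have hH j : j \in H -> rootdist i j <= rootdist i j /\ r <= rootdist i j.
  by move=> jH; split => //; exact: dH.
apply: le_trans (lower_gen cH r0 (ltW (dist_lt _ _)) dn hH).
rewrite lee_fin -/P /low_const.
apply: le_trans (_ : (2 ^+ N) `^ (- delta) / 4 * (r `^ (- s) * P `^ (- delta)) <= _).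
  rewrite ler_wpM2l ?divr_ge0 ?powR_ge0 // -powR_normal //.
  by apply: powR_antitone; rewrite ?mulr_gt0 ?exprn_gt0 ?invr_ge0.
rewrite le_eqVlt; apply/orP; left; apply/eqP.
rewrite !powRM ?mulr_ge0 ?exprn_ge0 ?(ltW r0) ?(ltW P0) //.
rewrite -(powR_mulrn k (ltW r0)) -powRrM mulrN kdelta.
rewrite -(powR_mulrn 2 (ltW r0)) opprD addrC powRD; last first.
  by rewrite (gt_eqF r0) implybT.
rewrite (powRN r 2).
have h : r `^ 2 != 0 by rewrite gt_eqF // powR_gt0.
by field; rewrite h.
Qed.

(** If [Bval i] vanishes, so does the [k]-th smallest distance; the lower bound at radius [rho] is
    then at least [K * rho ^ (-s)], which is unbounded as [rho] tends to 0. *)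
Lemma intQ_eq_pinfty i : Bval i = 0 -> intQ A Lambda delta = +oo%E.
Proof.
move=> B0; have hk : (0 < k <= N)%N by rewrite k_gt0.
have [H [j0 [cH j0H dn dH]]] := kth_split (rootdist i) hk.
have r0 : rootdist i j0 = 0.
  apply/eqP; apply: contraTT (lexx (0 : R)) => r_neq0.
  have r_gt0 : 0 < rootdist i j0 by rewrite lt_def r_neq0 dist0.
  rewrite -ltNge -{2}B0.
  have h : rootdist i j0 ^+ E * \prod_(j in H) rootdist i j ^+ D <= Bval i.
    by apply: Bsum_lower => //; [exact: ltnW | rewrite cH].
  apply: lt_le_trans h; rewrite mulr_gt0 ?exprn_gt0 //.
  apply: prodr_gt0 => j jH; rewrite exprn_gt0 //.
  exact: lt_le_trans (dH j jH).
apply/eqyP => M M0.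
pose K : R := (2 ^+ N * Lambda ^+ (N - k)) `^ (- delta) / 4.
have K0 : 0 < K by rewrite divr_gt0 ?powR_gt0 ?mulr_gt0 ?exprn_gt0.
(* [v] solves [K * v ^ (-s) = M]. *)
pose v : R := (K / M) `^ s^-1.
have v0 : 0 < v by apply: powR_gt0; exact: divr_gt0.
pose rho := Num.min Lambda v.
have rho0 : 0 < rho by rewrite lt_min Lambda_gt0 v0.
have rhoL : rho <= Lambda by rewrite ge_min lexx.
have dn' j : j \notin H -> rootdist i j <= rho.
  by move=> /dn; rewrite r0 => h; apply: le_trans h (ltW rho0).
have hH j : j \in H -> rootdist i j <= Lambda /\ rho <= Lambda.
  by move=> _; split => //; exact: ltW.
apply: le_trans (lower_gen cH rho0 rhoL dn' hH); rewrite lee_fin.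
rewrite prodr_const cH.
apply: le_trans (_ : K * rho `^ (- s) <= _).
  have ME : M = K * v `^ (- s).
    have s_neq0 : s != 0 by rewrite gt_eqF.
    have K_neq0 : K != 0 by rewrite gt_eqF.
    rewrite /v -powRrM mulrN mulVf // powR_inv1; last exact: ltW (divr_gt0 K0 M0).
    by rewrite invf_div mulrCA divff // mulr1.
  rewrite [leLHS]ME; apply: ler_wpM2l; first exact: ltW.
  by apply: powR_antitone; rewrite ?(ltW s_gt0) // ge_min lexx orbT.
rewrite le_eqVlt; apply/orP; left; apply/eqP; rewrite /K.
rewrite !powRM ?mulr_ge0 ?exprn_ge0 ?(ltW rho0) ?(ltW Lambda_gt0) //.
rewrite -(powR_mulrn k (ltW rho0)) -powRrM mulrN kdelta.
rewrite -(powR_mulrn 2 (ltW rho0)) opprD addrC powRD; last first.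
  by rewrite (gt_eqF rho0) implybT.
rewrite (powRN rho 2).
have h : rho `^ 2 != 0 by rewrite gt_eqF // powR_gt0.
by field; rewrite h.
Qed.

Definition up_const : R :=
  majorant_const ((k%:R - 1) * delta) delta
  * ((2 ^+ N) `^ delta * (Bcard N D)%:R `^ (q%:R^-1)).

(** Near [al i], [|Q|] is at least a multiple of [rho ^ (k - 1) * max(rho, r i) * P i]. The majorant
    with [a = (k - 1) * delta], [b = delta] and scale [r i] then has integral of order
    [r i ^ (-s)]. *)
Lemma intQ_le_Bval : (forall i, 0 < Bval i) ->
  (intQ A Lambda delta
    <= (up_const * \sum_i Bval i `^ (- q%:R^-1))%:E)%E.
Proof.
move=> B0; have hk : (0 < k <= N)%N by rewrite k_gt0.
have ex_H i : exists Hj : {set 'I_N} * 'I_N, [/\ #|Hj.1| = (N - k)%N,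
    Hj.2 \notin Hj.1,
    forall j, j \notin Hj.1 -> rootdist i j <= rootdist i Hj.2 &
    forall j, j \in Hj.1 -> rootdist i Hj.2 <= rootdist i j].
  by have [H [j0 h]] := kth_split (rootdist i) hk; exists (H, j0).
pose Hj i := projT1 (cid (ex_H i)); pose H i := (Hj i).1; pose j0 i := (Hj i).2.
have hH i : [/\ #|H i| = (N - k)%N, j0 i \notin H i,
    forall j, j \notin H i -> rootdist i j <= rootdist i (j0 i) &
    forall j, j \in H i -> rootdist i (j0 i) <= rootdist i j].
  exact: projT2 (cid (ex_H i)).
pose r i := rootdist i (j0 i).
pose P i := \prod_(j in H i) rootdist i j.
have Bup i : Bval i <= (Bcard N D)%:R * (r i ^+ E * P i ^+ D).
  have [cH _ dn dH] := hH i.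
  rewrite /P -prodrXl; apply: Bsum_le => [|u hu].
    apply: mulr_ge0; first by apply: exprn_ge0; exact: dist0.
    by apply: prodr_ge0 => j _; rewrite exprn_ge0.
  apply: knapsack_le; [exact: dist0 | exact: dist0 | exact: dn | | | ].
  - by move=> j hj; split => //; exact: dH.
  - by move=> j; rewrite -ltnS.
  - by rewrite hu /T cH.
have r0 i : 0 < r i.
  rewrite lt_def dist0 andbT; apply: contraTN (B0 i) => /eqP r0.
  rewrite -leNgt; apply: le_trans (Bup i) _.
  by rewrite r0 expr0n gtn_eqF // mul0r mulr0.
have P0 i : 0 < P i.
  have [_ _ _ dH] := hH i.
  by apply: prodr_gt0 => j /dH; exact: lt_le_trans (r0 i).
pose kap i := (2 ^+ N) `^ delta * P i `^ (- delta).
have k1 : (k%:R - 1) * delta = 2 + s - delta by rewrite mulrBl mul1r kdelta.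
have a0 : 0 <= (k%:R - 1) * delta.
  by rewrite mulr_ge0 ?(ltW delta_gt0) // subr_ge0 ler1n.
have a2 : (k%:R - 1) * delta < 2 by rewrite k1 -addrA gtrDl subr_lt0.
have ab2 : 2 < (k%:R - 1) * delta + delta by rewrite k1 subrK ltrDl.
apply: le_trans (intQ_upper (c := al) (kap := kap) (d := r) a0 a2 ab2 _ r0 _) _.
- by move=> i; rewrite mulr_gt0 ?powR_gt0 // exprn_gt0.
- move=> p _.
  (* The point is attached to its nearest root, which makes [rootdist i j] at most twice its
     distance to [al j]. *)
  have [i _ imin] := @arg_minP _ _ 'I_N (Ordinal (leq_trans k_gt0 k_le)) xpredT
    (fun j => cmod (cpt p - al j)) isT.
  exists i; have [pi|pi] := eqVneq (cpt p) (al i); first by left.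
  right; have rho0 : 0 < cmod (cpt p - al i) by rewrite cmod_gt0 subr_eq0.
  split.
    rewrite QE; apply/prodf_neq0 => j _; rewrite -cmod_gt0.
    exact: lt_le_trans (imin j isT).
  set rho := cmod (cpt p - al i) in rho0 imin *.
  have [cH jH dn dH] := hH i.
  have half j : rootdist i j <= 2 * cmod (cpt p - al j).
    apply: le_trans (cmodB_triangle _ (cpt p) _) _; rewrite cmodBC -/rho.
    by have := imin j isT; lra.
  have mx0 : 0 < Num.max rho (r i) by rewrite lt_max rho0.
  (* The factors in [H] give [P i], the factor [j0 i] gives the maximum, and the other [k - 1]
     factors are at least [rho]. *)
  have low : (2 ^+ N)^-1 * (rho ^+ k.-1 * Num.max rho (r i) * P i)
      <= cmod (Qpoly A (cpt p)).
    rewrite ler_pdivrMl ?exprn_gt0 // cmodQ -[N in 2 ^+ N]card_ord.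
    rewrite -prodr_const -big_split /= (prod_split (H i)) mulrC.
    apply: ler_pM.
    - exact: ltW.
    - by rewrite mulr_ge0 ?exprn_ge0 // ltW.
    - by apply: ler_prod => j _; rewrite dist0 /=.
    rewrite (bigD1 (j0 i)) //= mulrC; apply: ler_pM.
    - exact: ltW.
    - by rewrite exprn_ge0 // ltW.
    - have := half (j0 i); have := imin (j0 i) isT; rewrite -/(r i) ge_max => h1 h2.
      by rewrite h2 andbT; lra.
    have -> : rho ^+ k.-1 = \prod_(j | (j \notin H i) && (j != j0 i)) rho.
      rewrite -[in LHS](card_notin cH) (cardD1 (j0 i)) inE jH add1n /= -prodr_const.
      by apply: eq_bigl => j; rewrite !inE andbC.
    apply: ler_prod => j _; rewrite (ltW rho0) /=.
    by have := imin j isT; lra.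
  have low0 : 0 < (2 ^+ N)^-1 * (rho ^+ k.-1 * Num.max rho (r i) * P i).
    by rewrite !mulr_gt0 ?invr_gt0 ?exprn_gt0.
  apply: le_trans (powR_antitone low0 low (ltW delta_gt0)) _.
  rewrite !powRM ?mulr_ge0 ?invr_ge0 ?exprn_ge0 ?(ltW rho0) ?(ltW mx0) ?(ltW (P0 i)) //.
  rewrite -[(2 ^+ N)^-1]powR_inv1 ?exprn_ge0 // -powRrM mulrNN mul1r.
  rewrite -(powR_mulrn k.-1 (ltW rho0)) -powRrM mulrN.
  have -> : k.-1%:R = k%:R - 1 :> R by rewrite -[in RHS](prednK k_gt0) -natr1 addrK.
  by rewrite /kap le_eqVlt; apply/orP; left; apply/eqP; ring.
rewrite lee_fin /up_const -mulrA.
apply: ler_wpM2l.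
  rewrite /majorant_const; have l2 : 0 < ln (2 : R) by rewrite ln_gt0 // ltr1n.
  have lt1 (x : R) : x < 0 -> 0 <= 1 - 2 `^ x.
    by move=> x0; rewrite subr_ge0 ltW // powRE_expR // expR_lt1 pmulr_llt0.
  rewrite addr_ge0 // divr_ge0 ?mulr_ge0 ?powR_ge0 //; apply: lt1.
    by rewrite subr_lt0.
  by rewrite -addrA -opprD subr_lt0.
rewrite mulr_sumr; apply: ler_sum => i _.
have -> : 2 - (k%:R - 1) * delta - delta = - s by rewrite k1; ring.
rewrite /kap -!mulrA ler_wpM2l ?powR_ge0 // [leLHS]mulrC -powR_normal //.
have Bc0 : 0 < (Bcard N D)%:R :> R.
  have := lt_le_trans (B0 i) (Bup i).
  by rewrite pmulr_lgt0 // mulr_gt0 ?exprn_gt0.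
have -> : (Bcard N D)%:R `^ q%:R^-1 = ((Bcard N D)%:R^-1) `^ (- q%:R^-1) :> R.
  by rewrite -[(Bcard N D)%:R^-1]powR_inv1 ?(ltW Bc0) // -powRrM mulrNN mul1r.
rewrite -powRM ?invr_ge0 ?Bval_ge0 ?(ltW Bc0) //.
apply: powR_antitone; rewrite ?mulr_gt0 ?invr_gt0 ?invr_ge0 //.
by rewrite ler_pdivrMl.
Qed.

End Points.
End RootDistances.

(** * Polynomial families for the sum of the reciprocals of the [B_i] *)

Section Families.
Variables (R : realType) (N D T : nat).

Local Notation weights := {ffun 'I_N -> {ffun 'I_N -> 'I_D.+1}}.
Implicit Types (w : weights) (al : 'I_N -> R[i]) (s : 'S_N).

Definition wt_ok w := [forall i, (\sum_j w i j == T)%N].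

(** A term of the expanded product of all the [B_i]; row [i] of [w] selects the monomial from [B_i].
    Inadmissible [w] give 0, which keeps the index set a plain finite type. *)
Definition fden w : zpoly N :=
  if wt_ok w then \prod_i \prod_j ('X_i - 'X_j) ^+ w i j else 0.

(** Row [x.1] is left out of the product but still belongs to the index, so each product recurs once
    for every admissible row; [Ucard] counts them. *)
Definition fnum (x : 'I_N * weights) : zpoly N :=
  if wt_ok x.2 then \prod_(i | i != x.1) \prod_j ('X_i - 'X_j) ^+ x.2 i j else 0.

Definition relabel s w : weights :=
  [ffun i => [ffun j => w ((s^-1)%g i) ((s^-1)%g j)]].

Lemma relabel_inj s : injective (relabel s).
Proof.
apply: (can_inj (g := relabel (s^-1)%g)) => w.
by apply/ffunP => i; rewrite ffunE; apply/ffunP => j; rewrite !ffunE invgK !permK.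
Qed.

Lemma relabelE s w i j : relabel s w (s i) (s j) = w i j.
Proof. by rewrite !ffunE !permK. Qed.

Lemma wt_ok_relabel s w : wt_ok (relabel s w) = wt_ok w.
Proof.
have sum_row i : (\sum_j relabel s w (s i) j = \sum_j w i j)%N.
  by rewrite (reindex_inj (@perm_inj _ s)); apply: eq_bigr => j _; rewrite relabelE.
apply/forallP/forallP => h i; first by rewrite -sum_row.
by rewrite -(permKV s i) sum_row.
Qed.

Lemma msymXU s (i : 'I_N) : msym s ('X_i : zpoly N) = 'X_(s i).
Proof. by rewrite /msym mmapX mmap1U. Qed.

Lemma msym_diffX s (i j : 'I_N) (n : nat) :
  msym s (('X_i - 'X_j) ^+ n : zpoly N) = ('X_(s i) - 'X_(s j)) ^+ n.
Proof. by rewrite rmorphXn rmorphB /= !msymXU. Qed.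

Lemma fden_perm s :
  exists2 pi : weights -> weights, injective pi &
    forall w, msym s (fden w) = fden (pi w).
Proof.
exists (relabel s); first exact: relabel_inj.
move=> w; rewrite /fden wt_ok_relabel; case: ifP => _; last exact: rmorph0.
rewrite rmorph_prod [RHS](reindex_inj (@perm_inj _ s)) /=.
apply: eq_bigr => i _.
rewrite rmorph_prod [RHS](reindex_inj (@perm_inj _ s)) /=.
by apply: eq_bigr => j _; rewrite relabelE; exact: msym_diffX.
Qed.

Lemma fnum_perm s :
  exists2 pi : 'I_N * weights -> 'I_N * weights, injective pi &
    forall x, msym s (fnum x) = fnum (pi x).
Proof.
exists (fun x => (s x.1, relabel s x.2)).
  by move=> [i w] [j v] [] /perm_inj -> /relabel_inj ->.
move=> [i0 w]; rewrite /fnum /= wt_ok_relabel; case: ifP => _; last exact: rmorph0.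
rewrite rmorph_prod [RHS](reindex_inj (@perm_inj _ s)) /=.
apply: eq_big => [i|i _]; first by rewrite (inj_eq (@perm_inj _ s)).
rewrite rmorph_prod [RHS](reindex_inj (@perm_inj _ s)) /=.
by apply: eq_bigr => j _; rewrite relabelE; exact: msym_diffX.
Qed.

Lemma zeval_diffX al (i j : 'I_N) (n : nat) :
  zeval (('X_i - 'X_j) ^+ n : zpoly N) al = (al i - al j) ^+ n.
Proof. by rewrite [LHS]rmorphXn rmorphB; congr ((_ - _) ^+ _); exact: zevalXU. Qed.

Lemma cmod_zeval_prod al (P : pred 'I_N) w :
  cmod (zeval (\prod_(i | P i) \prod_j ('X_i - 'X_j) ^+ w i j : zpoly N) al)
  = \prod_(i | P i) \prod_j cmod (al i - al j) ^+ w i j.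
Proof.
rewrite [zeval _ _]rmorph_prod (big_morph _ (@cmodM R) (@cmod1 R)).
apply: eq_bigr => i _.
rewrite [X in cmod X]rmorph_prod (big_morph _ (@cmodM R) (@cmod1 R)).
by apply: eq_bigr => j _; rewrite -cmodX; congr cmod; exact: zeval_diffX.
Qed.

Let B al i := Bsum D T (fun j => cmod (al i - al j)).

Lemma sum_fden al : \sum_w cmod (zeval (fden w) al) = \prod_i B al i.
Proof.
rewrite /B /Bsum; under [RHS]eq_bigr => i _ do rewrite big_mkcond /=.
rewrite bigA_distr_bigA; apply: eq_bigr => w _ /=; rewrite /fden.
have [/forallP h|] := boolP (wt_ok w).
  by rewrite cmod_zeval_prod; apply: eq_bigr => i _; rewrite h.
rewrite negb_forall => /existsP[i hi].
by rewrite [zeval _ _]rmorph0 cmod0 (bigD1 i) //= (negbTE hi) mul0r.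
Qed.

Definition Ucard : R :=
  \sum_(u : {ffun 'I_N -> 'I_D.+1} | (\sum_j u j == T)%N) 1.

Lemma sum_fnum al : \sum_x cmod (zeval (fnum x) al)
  = Ucard * \sum_i \prod_(i' | i' != i) B al i'.
Proof.
rewrite mulr_sumr -(pair_bigA _ (fun i w => cmod (zeval (fnum (i, w)) al))) /=.
apply: eq_bigr => i0 _.
(* The omitted row gets the factor 1, so that distributivity applies to all rows at once. *)
pose F (i : 'I_N) (u : {ffun 'I_N -> 'I_D.+1}) : R := if (\sum_j u j == T)%N
  then if i == i0 then 1 else \prod_j cmod (al i - al j) ^+ u j else 0.
transitivity (\prod_i \sum_u F i u); last first.
  rewrite (bigD1 i0) //=; congr (_ * _).
    by rewrite /Ucard [RHS]big_mkcond; apply: eq_bigr => u _; rewrite /F eqxx.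
  apply: eq_bigr => i /negbTE ii; rewrite /B /Bsum [RHS]big_mkcond.
  by apply: eq_bigr => u _; rewrite /F ii.
rewrite bigA_distr_bigA; apply: eq_bigr => w _ /=; rewrite /fnum /=.
have [/forallP h|] := boolP (wt_ok w).
  rewrite cmod_zeval_prod [RHS](bigD1 i0) //= /F h eqxx mul1r.
  by apply: eq_bigr => i /negbTE ->; rewrite h.
rewrite negb_forall => /existsP[i hi].
by rewrite [zeval _ _]rmorph0 cmod0 (bigD1 i) //= /F (negbTE hi) mul0r.
Qed.

End Families.

(** * The polynomial family for part (ii) *)

Section EdgeFamily.
Variables (R : realType) (n k D E : nat).

(** All orderings of the roots occur, because the one that sorts their projections is not known in
    advance and the family has to be symmetric. *)
Definition fedge (s : 'S_n.+1) : zpoly n.+1 :=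
  \prod_(z : edge n k) ('X_(s (esrc z)) - 'X_(s (etgt z))) ^+ emul D E z.

Lemma fedge_perm (s : 'S_n.+1) :
  exists2 pi : 'S_n.+1 -> 'S_n.+1, injective pi &
    forall t, msym s (fedge t) = fedge (pi t).
Proof.
exists (fun t => t * s)%g; first exact: mulIg.
move=> t; rewrite /fedge rmorph_prod; apply: eq_bigr => z _.
by rewrite !permM; exact: msym_diffX.
Qed.

Lemma cmod_fedge (al : 'I_n.+1 -> R[i]) (s : 'S_n.+1) :
  cmod (zeval (fedge s) al)
  = edge_prod k D E s (fun a b => cmod (al a - al b)).
Proof.
rewrite [zeval _ _]rmorph_prod cmod_prod; apply: eq_bigr => z _.
by rewrite -cmodX; congr cmod; exact: zeval_diffX.
Qed.

End EdgeFamily.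

(** * From estimates in the roots to the asymptotic formula *)

Section Assembly.
Variable R : realType.

Lemma powR_comparable (C Y S : R) (K q : nat) :
  0 < C -> 0 <= Y -> 0 <= S -> (0 < K)%N -> (0 < q)%N ->
  S ^+ (2 * K) <= C * Y -> Y <= C * S ^+ (2 * K) ->
  let e := ((q * K)%:R^-1 / 2 : R) in
  Y `^ e <= C `^ e * S `^ q%:R^-1 /\ S `^ q%:R^-1 <= C `^ e * Y `^ e.
Proof.
move=> C0 Y0 S0 K0 q0 h1 h2 e.
have e0 : 0 <= e by rewrite divr_ge0 ?invr_ge0.
have SE : S `^ q%:R^-1 = (S ^+ (2 * K)) `^ e.
  rewrite -powR_mulrn // -powRrM; congr (_ `^ _); rewrite /e !natrM.
  by field; rewrite !pnatr_eq0 -!lt0n q0 K0.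
rewrite SE -!powRM ?exprn_ge0 ?(ltW C0) //.
by split; apply: ge0_ler_powR; rewrite ?nnegrE ?mulr_ge0 ?exprn_ge0 ?(ltW C0).
Qed.

Lemma zeval1 N (a : 'I_N -> R[i]) : zeval (zpoly1 N) a = 1.
Proof. exact: rmorph1. Qed.

Lemma sumsq_one N (a : 'I_N -> R[i]) :
  sumsq (fun _ : 'I_1 => zpoly1 N) a = 1.
Proof. by rewrite /sumsq big_ord1 zeval1 cmod1 expr1n. Qed.

Lemma sumsq_ge0 N J (G : 'I_J -> zpoly N) (a : 'I_N -> R[i]) : 0 <= sumsq G a.
Proof. by apply: sumr_ge0 => j _; rewrite exprn_ge0 ?cmod_ge0. Qed.

Lemma sumsq_gt0 N J (G : 'I_J -> zpoly N) (a : 'I_N -> R[i]) :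
  (exists j, zeval (G j) a != 0) -> 0 < sumsq G a.
Proof.
move=> [j hj]; rewrite /sumsq (bigD1 j) //= ltr_wpDr ?exprn_gt0 ?cmod_gt0 //.
by apply: sumr_ge0 => i _; rewrite exprn_ge0 ?cmod_ge0.
Qed.

Definition family_norm N J (G : 'I_J -> zpoly N) (S : ('I_N -> R[i]) -> R)
    (K : nat) (C : R) : Prop :=
  [/\ (0 < K)%N, 0 < C, (forall al, 0 <= S al) & forall a al, vieta a al ->
    S al ^+ (2 * K) <= C * sumsq G a /\ sumsq G a <= C * S al ^+ (2 * K)].

Lemma family_norm_one N :
  family_norm (fun _ : 'I_1 => zpoly1 N) (fun=> 1) 1 1.
Proof. by split => // a al _; rewrite sumsq_one expr1n !mulr1. Qed.

Lemma family_norm_sum N (X : finType) (f : X -> zpoly N) :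
  (forall s : 'S_N,
     exists2 pi : X -> X, injective pi & forall x, msym s (f x) = f (pi x)) ->
  exists (J K : nat) (G : 'I_J -> zpoly N) (C : R),
    family_norm G (fun al => \sum_x cmod (zeval (f x) al)) K C.
Proof.
move=> /(symmetric_family_norm R) [J [K [G [C [K0 C0 h]]]]].
by exists J, K, G, C; split => // al; apply: sumr_ge0 => x _; exact: cmod_ge0.
Qed.

(** The common intermediate form of both parts of the theorem: the integral is comparable to
    [(S2 / S1) ^ (1/q)], functions of the roots, and infinite where [S1] vanishes. *)
Definition ratio_estimate N (Lambda delta : R) (q : nat)
    (S1 S2 : ('I_N -> R[i]) -> R) : Prop :=
  exists c C : R, [/\ 0 < c, 0 < C & forall A al : 'I_N -> R[i],
    (forall z, Qpoly A z = \prod_j (z - al j)) ->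
    (forall j, cmod (al j) < Lambda / 2) ->
    (S1 al = 0 -> intQ A Lambda delta = +oo%E) /\
    (0 < S1 al ->
      ((c * (S2 al / S1 al) `^ q%:R^-1)%:E <= intQ A Lambda delta)%E /\
      (intQ A Lambda delta <= (C * (S2 al / S1 al) `^ q%:R^-1)%:E)%E)].

Lemma intQ_ge0 N (A : 'I_N -> R[i]) (Lambda delta : R) :
  (0 <= intQ A Lambda delta)%E.
Proof. by apply: integral_ge0 => p _; exact: integrand_ge0. Qed.

(** Since [sumsq G] is comparable to [S1 ^ (2 * K1)], the power [S1 ^ (1/q)] is comparable to
    [sumsq G] to the power [1 / (2 * q * K1)], and [S2] likewise; the 2 is the halving in [rhs]. The
    [G j] vanish together exactly where [S1] does. *)
Lemma asymptotic_of_ratio N (Lambda : R) (delta : rat) (q I J K1 K2 : nat)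
    (F : 'I_I -> zpoly N) (G : 'I_J -> zpoly N)
    (S1 S2 : ('I_N -> R[i]) -> R) (D1 D2 : R) :
  (0 < q)%N -> family_norm G S1 K1 D1 -> family_norm F S2 K2 D2 ->
  ratio_estimate Lambda (ratr delta) q S1 S2 ->
  asymptotic_formula Lambda delta F G (q * K2)%:R^-1 (q * K1)%:R^-1.
Proof.
move=> q0 [K10 D10 S10 hG] [K20 D20 S20 hF] [c [C [c0 C0 hint]]].
pose e1 : R := (q * K1)%:R^-1 / 2; pose e2 : R := (q * K2)%:R^-1 / 2.
pose M := D1 `^ e1 * D2 `^ e2.
have M0 : 0 < M by rewrite mulr_gt0 ?powR_gt0.
exists (c / M), (C * M); rewrite divr_gt0 // mulr_gt0 //; do 2!split => //.
move=> a ha.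
have [al va QE] := Qpoly_roots a.
have al_lt j : cmod (al j) < Lambda / 2.
  by apply: ha; rewrite QE (bigD1 j) //= subrr mul0r.
have [int_oo int_fin] := hint a al QE al_lt.
have [hG1 hG2] := hG a al va; have [hF1 hF2] := hF a al va.
have [G1 G2] := powR_comparable D10 (sumsq_ge0 G a) (S10 al) K10 q0 hG1 hG2.
have [F1 F2] := powR_comparable D20 (sumsq_ge0 F a) (S20 al) K20 q0 hF1 hF2.
have fin : (exists j, zeval (G j) a != 0) ->
    intQ a Lambda (ratr delta) \is a fin_num /\
    rhs F G (q * K2)%:R^-1 (q * K1)%:R^-1 a \is a fin_num /\
    ((c / M)%:E * rhs F G (q * K2)%:R^-1 (q * K1)%:R^-1 a
       <= intQ a Lambda (ratr delta))%E /\
    (intQ a Lambda (ratr delta)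
       <= (C * M)%:E * rhs F G (q * K2)%:R^-1 (q * K1)%:R^-1 a)%E.
  move=> /sumsq_gt0 Y0.
  have S1_gt0 : 0 < S1 al.
    rewrite lt_def S10 andbT; apply: contraTN Y0 => /eqP S1_eq0.
    rewrite -leNgt; apply: le_trans hG2 _.
    by rewrite S1_eq0 expr0n muln_eq0 /= gtn_eqF // mulr0.
  have [lo up] := int_fin S1_gt0.
  have rhsE : rhs F G (q * K2)%:R^-1 (q * K1)%:R^-1 a
      = (sumsq F a `^ e2 * sumsq G a `^ (- e1))%:E.
    have ratrV m : ratr (m%:R^-1) = m%:R^-1 :> R by rewrite fmorphV /= ratr_nat.
    rewrite /rhs /epow !ratrV -/e1 -/e2 (gt_eqF Y0) /= EFinM.
    have -> : (e2 < 0) = false by apply/negbTE; rewrite -leNgt divr_ge0 ?invr_ge0.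
    by rewrite andbF.
  rewrite rhsE; set x := sumsq F a `^ e2 * _.
  have y0 : 0 < sumsq G a `^ e1 by exact: powR_gt0.
  have t0 : 0 < S1 al `^ q%:R^-1 by exact: powR_gt0.
  have yE : (S2 al / S1 al) `^ q%:R^-1 = S2 al `^ q%:R^-1 / S1 al `^ q%:R^-1.
    rewrite powRM ?invr_ge0 //; congr (_ * _).
    by rewrite -[(S1 al)^-1]powR_inv1 // -powRrM mulN1r powRN.
  have xE : x = sumsq F a `^ e2 / sumsq G a `^ e1 by rewrite /x powRN.
  have x_le : x <= M * (S2 al / S1 al) `^ q%:R^-1.
    rewrite xE yE ler_pdivrMr // /M mulrA mulrAC ler_pdivlMr //.
    rewrite [X in _ <= X](_ : _ = (D2 `^ e2 * S2 al `^ q%:R^-1)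
      * (D1 `^ e1 * sumsq G a `^ e1)); last by ring.
    by apply: ler_pM => //; exact: powR_ge0.
  have le_x : (S2 al / S1 al) `^ q%:R^-1 <= M * x.
    rewrite xE yE ler_pdivrMr // /M mulrA mulrAC ler_pdivlMr //.
    rewrite [X in _ <= X](_ : _ = (D2 `^ e2 * sumsq F a `^ e2)
      * (D1 `^ e1 * S1 al `^ q%:R^-1)); last by ring.
    by apply: ler_pM => //; exact: powR_ge0.
  split; last split => //.
    rewrite ge0_fin_numE ?intQ_ge0 //; exact: le_lt_trans up (ltry _).
  split; rewrite -EFinM.
    apply: le_trans lo; rewrite lee_fin -mulrA ler_pM2l //.
    by rewrite ler_pdivrMl.
  by apply: le_trans up _; rewrite lee_fin -mulrA ler_pM2l.
split => //; split => [oo j|allG].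
  apply/eqP; apply: contraT => Gj; exfalso.
  by have [] := fin (ex_intro _ j Gj); rewrite oo.
have Y0 : sumsq G a = 0.
  by rewrite /sumsq big1 // => j _; rewrite allG cmod0 expr0n.
apply: int_oo; apply/eqP; apply: contraTT hG1 => S1_neq0.
by rewrite Y0 mulr0 -ltNge exprn_gt0 // lt_def S1_neq0 S10.
Qed.

End Assembly.

(** * The ratio estimates, without and with a critical [k] *)

Section Estimates.
Variable R : realType.

Lemma ratio_estimate_one N D q (Lambda : R) :
  (0 < q)%N -> (N * D < 2 * q)%N -> 0 < Lambda ->
  @ratio_estimate R N Lambda (D%:R / q%:R) 1 (fun=> 1) (fun=> 1).
Proof.
move=> q0 NDq L0; set delta : R := D%:R / q%:R.
have delta0 : 0 <= delta by rewrite divr_ge0.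
pose a := N%:R * delta.
have a0 : 0 <= a by rewrite mulr_ge0.
have a2 : a < 2.
  rewrite /a /delta mulrA ltr_pdivrMr ?ltr0n // -natrM.
  by rewrite -[2]/(2%:R) -natrM ltr_nat.
(* Here [a = N * delta], and [b = 3] makes [a + b > 2] even for [a = 0]. The scale [d = 2 * Lambda]
   exceeds every distance that occurs, so the maximum is always [d] and the weight [d ^ 3] cancels
   it. *)
have ab2 : 2 < a + 3 by lra.
pose d := 2 * Lambda; have d0 : 0 < d by rewrite mulr_gt0.
pose c := (Lambda ^+ N) `^ (- delta) * (Lambda ^+ 2 / 4).
have c0 : 0 < c by rewrite !mulr_gt0 ?powR_gt0 ?exprn_gt0 ?invr_gt0.
pose C := majorant_const a 3 * \sum_(i < N.+1) d `^ 3 * d `^ (2 - a - 3).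
exists c, (1 + `|C|); rewrite c0 ltr_pwDl //; split => // A al QE al_lt.
split=> [/eqP|_]; first by rewrite oner_eq0.
rewrite divr1 powR1 !mulr1; split.
  apply: (intQ_lower (c := 0)) => // [||z hz]; first by rewrite cmod0 divr_gt0.
    by rewrite exprn_gt0.
  rewrite QE cmod_prod -[N in leRHS]card_ord -prodr_const.
  apply: ler_prod => j _; rewrite cmod_ge0 /=; apply: le_trans (cmodD _ _) _.
  by rewrite cmodN; move: hz; rewrite subr0; have := al_lt j; lra.
apply: (@le_trans _ _ C%:E); last first.
  by rewrite lee_fin (le_trans (ler_norm _)) // lerDr.
(* The extra centre 0 provides a centre when [N = 0]. *)
pose cc (i : 'I_N.+1) : R[i] := if unlift ord0 i is Some j then al j else 0.
apply: (intQ_upper (c := cc) (kap := fun=> d `^ 3) (d := fun=> d)) => //.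
  by move=> _; exact: powR_gt0.
move=> p /(diskP _ L0) pL.
have cc_lt i : cmod (cc i) < Lambda / 2.
  by rewrite /cc; case: unlift => [j|]; [exact: al_lt | rewrite cmod0 divr_gt0].
have [i [pi|[Q0 hi]]] : exists i, cpt p = cc i \/ (Qpoly A (cpt p) != 0 /\
    cmod (cpt p - cc i) ^+ N <= cmod (Qpoly A (cpt p))).
  have [N0|N0] := posnP N.
    exists ord0; right; have -> : Qpoly A (cpt p) = 1.
      by rewrite QE big1 // => j; have := ltn_ord j; lia.
    by rewrite oner_eq0 cmod1; move: (cmod _) => x; rewrite N0 expr0.
  have [i _ imin] := @arg_minP _ _ 'I_N (Ordinal N0) xpredT
    (fun j => cmod (cpt p - al j)) isT.
  exists (lift ord0 i); rewrite /cc liftK.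
  have [pi|pi] := eqVneq (cpt p) (al i); [by left | right].
  have rho0 : 0 < cmod (cpt p - al i) by rewrite cmod_gt0 subr_eq0.
  split.
    rewrite QE; apply/prodf_neq0 => j _; rewrite -cmod_gt0.
    exact: lt_le_trans (imin j isT).
  rewrite QE cmod_prod -[N in leLHS]card_ord -prodr_const.
  by apply: ler_prod => j _; rewrite cmod_ge0 /= imin.
- by exists i; left.
exists i; have [pi|pi] := eqVneq (cpt p) (cc i); [by left | right; split => //].
have rho0 : 0 < cmod (cpt p - cc i) by rewrite cmod_gt0 subr_eq0.
have rhod : cmod (cpt p - cc i) <= d.
  apply: le_trans (cmodD _ _) _; rewrite cmodN /d.
  by have := cc_lt i; lra.
rewrite max_r // mulrCA -powRD; last by rewrite (gt_eqF d0) implybT.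
rewrite subrr powRr0 mulr1.
apply: le_trans (powR_antitone _ hi delta0) _; first by rewrite exprn_gt0.
by rewrite -powR_mulrn ?(ltW rho0) // -powRrM mulrN.
Qed.

Section Critical.
Variables (N k D E q : nat) (Lambda : R).
Hypotheses (k_gt0 : (0 < k)%N) (k_le : (k <= N)%N) (q_gt0 : (0 < q)%N).
Hypotheses (E_gt0 : (0 < E)%N) (E_lt : (E < D)%N) (kD : (k * D = 2 * q + E)%N).
Hypothesis Lambda_gt0 : 0 < Lambda.

Local Notation B al i := (@Bval R N k D E al i).

(** It suffices that [S2 / S1] be comparable to the largest [1 / B_i]: one root gives the lower
    bound for the integral, and the upper bound sums [N] terms. *)
Lemma ratio_estimate_Bval (S1 S2 : ('I_N -> R[i]) -> R) (M : R) : 0 < M ->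
  (forall al, S1 al = 0 -> exists i, B al i = 0) ->
  (forall al, 0 < S1 al ->
     (forall i, 0 < B al i /\ (B al i)^-1 <= M * (S2 al / S1 al)) /\
     (exists i, S2 al / S1 al <= M * (B al i)^-1)) ->
  ratio_estimate Lambda (D%:R / q%:R) q S1 S2.
Proof.
move=> M0 h0 h1.
have N0 : (0 < N)%N by exact: leq_trans k_le.
have q0 : 0 <= q%:R^-1 :> R by rewrite invr_ge0.
have VpowR (x : R) : 0 < x -> x^-1 `^ q%:R^-1 = x `^ (- q%:R^-1).
  by move=> x0; rewrite -[x^-1]powR_inv1 ?(ltW x0) // -powRrM mulN1r.
pose lc := low_const R N D q; pose uc := up_const R N k D q.
have lc0 : 0 < lc by rewrite divr_gt0 // powR_gt0 // exprn_gt0.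
exists (lc / M `^ q%:R^-1), (1 + `|uc * (N%:R * M `^ q%:R^-1)|).
rewrite divr_gt0 ?powR_gt0 // ltr_pwDl //; split => // A al QE al_lt.
split=> [/h0[i Bi]|/h1[hi [i0 hi0]]].
  exact: (intQ_eq_pinfty k_gt0 k_le q_gt0 E_gt0 E_lt kD Lambda_gt0 QE al_lt Bi).
set x := S2 al / S1 al in hi hi0 *.
have x0 : 0 < x.
  have [Bi] := hi i0; rewrite -invr_gt0 in Bi => h.
  by have := lt_le_trans Bi h; rewrite pmulr_rgt0.
split.
  have [Bi0 _] := hi i0.
  have lo := intQ_ge_Bval k_gt0 k_le q_gt0 E_gt0 E_lt kD Lambda_gt0 QE al_lt Bi0.
  apply: le_trans lo; rewrite lee_fin -/lc -mulrA ler_pM2l //.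
  rewrite ler_pdivrMl ?powR_gt0 // -VpowR // -powRM ?invr_ge0 ?(ltW M0) ?(ltW Bi0) //.
  apply: ge0_ler_powR => //; rewrite nnegrE ltW //.
  by rewrite mulr_gt0 ?invr_gt0.
have Bpos i : 0 < B al i by have [] := hi i.
have up := intQ_le_Bval k_gt0 k_le q_gt0 E_gt0 E_lt kD Lambda_gt0 QE Bpos.
apply: le_trans up _; rewrite lee_fin -/uc.
apply: le_trans (_ : `|uc| * (N%:R * M `^ q%:R^-1 * x `^ q%:R^-1) <= _).
  apply: le_trans (_ : `|uc| * \sum_i B al i `^ (- q%:R^-1) <= _).
    by rewrite ler_wpM2r ?ler_norm // sumr_ge0 // => i _; exact: powR_ge0.
  apply: ler_wpM2l => //.
  apply: le_trans (_ : \sum_(i < N) (M `^ q%:R^-1 * x `^ q%:R^-1) <= _); last first.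
    by rewrite sumr_const card_ord -[leLHS]mulr_natl mulrA.
  apply: ler_sum => i _; rewrite -VpowR //.
  have [_ h] := hi i; rewrite -powRM ?(ltW M0) ?(ltW x0) //.
  apply: ge0_ler_powR => //; rewrite nnegrE ltW // ?invr_gt0 //.
  exact: mulr_gt0.
have NM0 : 0 <= N%:R * M `^ q%:R^-1 by rewrite mulr_ge0 ?powR_ge0.
rewrite [leLHS]mulrA; apply: ler_wpM2r; first exact: powR_ge0.
by rewrite -{1}(ger0_norm NM0) -normrM lerDr.
Qed.

Lemma ratio_estimate_general :
  ratio_estimate Lambda (D%:R / q%:R) q
    (fun al => \prod_i B al i)
    (fun al => Ucard R N D (E + (N - k) * D)
               * \sum_i \prod_(i' | i' != i) B al i').
Proof.
set U := Ucard _ _ _ _.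
have U0 : 0 <= U by apply: sumr_ge0.
have N0 : (0 < N)%N by exact: leq_trans k_le.
apply: (@ratio_estimate_Bval _ _ ((U + 1) * N%:R)).
- by rewrite mulr_gt0 ?ltr0n // ltr_wpDl.
- by move=> al /eqP; rewrite prodf_seq_eq0 => /hasP[i _ /eqP h]; exists i.
move=> al S1_gt0.
have Bpos i : 0 < B al i.
  rewrite lt_def Bval_ge0 andbT; apply: contraTneq S1_gt0 => h.
  by rewrite (bigD1 i) //= h mul0r ltxx.
have ratioE : U * (\sum_i \prod_(i' | i' != i) B al i') / (\prod_i B al i)
    = U * \sum_i (B al i)^-1.
  rewrite -mulrA mulr_suml; congr (_ * _); apply: eq_bigr => i _.
  rewrite [X in _ / X](bigD1 i) //= invfM mulrCA mulfV ?mulr1 //.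
  by apply/prodf_neq0 => j _; rewrite gt_eqF.
(* A positive [B_i] has at least one term, and [U] counts the possible terms. *)
have U1 : 1 <= U.
  have i0 := Ordinal N0.
  have [u hu] : exists u : {ffun 'I_N -> 'I_D.+1},
      (\sum_j u j == E + (N - k) * D)%N.
    apply: contrapT => h; have := Bpos i0; rewrite /Bval /Bsum big_pred0 ?ltxx //.
    by move=> u; apply/negbTE/negP => hu; apply: h; exists u.
  by rewrite /U /Ucard (bigD1 u) //= lerDl sumr_ge0.
rewrite ratioE; split.
  move=> i; split => //.
  apply: le_trans (_ : \sum_j (B al j)^-1 <= _).
    rewrite (bigD1 i) //= lerDl sumr_ge0 // => j _; by rewrite invr_ge0 ltW.
  have s0 : 0 <= \sum_j (B al j)^-1.
    by apply: sumr_ge0 => j _; rewrite invr_ge0 ltW.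
  rewrite mulrA ler_peMl // mulr_ege1 // ?mulr_ege1 ?ler1n //.
  by rewrite lerDr.
have [i _ imin] := @arg_minP _ _ 'I_N (Ordinal N0) xpredT (fun i => B al i) isT.
exists i; rewrite -mulrA; apply: ler_pM => //.
- by apply: sumr_ge0 => j _; rewrite invr_ge0 ltW.
- by rewrite lerDl.
apply: le_trans (_ : \sum_(j < N) (B al i)^-1 <= _); last first.
  by rewrite sumr_const card_ord -[leLHS]mulr_natl.
by apply: ler_sum => j _; rewrite lef_pV2 ?posrE // imin.
Qed.

End Critical.

(** The edge sum is comparable to the smallest [B_i]: it is at most [M1 * B_i] for every [i], and
    some [B_i] is at most [M2] times it. The constants [c1] and [c2] are the distortions of the real
    projection. *)
Lemma ratio_estimate_edges n k D E q (Lambda : R) :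
  (0 < k)%N -> (k <= n.+1)%N -> (0 < q)%N -> (0 < E)%N -> (E < D)%N ->
  (k * D = 2 * q + E)%N -> (n.+1 < 2 * k)%N ->
  ((n.+2 = 2 * k)%N -> (2 * E <= D)%N) -> 0 < Lambda ->
  ratio_estimate Lambda (D%:R / q%:R) q
    (fun al => \sum_(s : 'S_n.+1) cmod (zeval (fedge k D E s) al)) (fun=> 1).
Proof.
move=> k_gt0 k_le q_gt0 E_gt0 E_lt kD n_lt E_half L0.
have ED := ltnW E_lt.
pose T := (E + (n.+1 - k) * D)%N.
pose M1 : R := (#|{: 'S_n.+1}|)%:R * 2 ^+ T.
pose c1 : R := (3 + 2 * n.+1 ^ 2)%:R; pose c2 : R := (1 + n.+1 ^ 2)%:R.
pose M2 : R := c1 ^+ T * ((Bcard n.+1 D)%:R * 2 ^+ ((n.+1 - k) * D) * c2 ^+ T).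
have M10 : 0 <= M1 by rewrite mulr_ge0 ?exprn_ge0.
have M20 : 0 <= M2 by rewrite !mulr_ge0 ?exprn_ge0.
have S_le al i : \sum_(s : 'S_n.+1) cmod (zeval (fedge k D E s) al)
    <= M1 * Bval k D E al i.
  rewrite /M1 -sum1_card natr_sum -mulrA mulr_suml; apply: ler_sum => s _.
  rewrite mul1r cmod_fedge.
  apply: (edge_prod_le_Bsum k_gt0 k_le n_lt ED E_half) => [a b|a b].
    exact: cmod_ge0.
  by rewrite (cmodBC (al i) (al a)); exact: cmodB_triangle.
have le_S al : exists i, Bval k D E al i
    <= M2 * \sum_(s : 'S_n.+1) cmod (zeval (fedge k D E s) al).
  have [phi hphi] := real_projection al.
  have [i [s hs]] := Bsum_le_edge_prod k_gt0 k_le n_lt ED E_half phi.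
  exists i; rewrite /M2 -mulrA.
  apply: le_trans (_ : c1 ^+ T * Bsum D T (fun j => `|phi i - phi j|) <= _).
    apply: Bsum_scale => j; first exact: cmod_ge0.
    by have [] := hphi i j.
  rewrite ler_wpM2l ?exprn_ge0 //; apply: le_trans hs _.
  rewrite -[leRHS]mulrA ler_wpM2l ?mulr_ge0 ?exprn_ge0 //.
  apply: le_trans (_ : c2 ^+ T * cmod (zeval (fedge k D E s) al) <= _).
    rewrite cmod_fedge /edge_prod /T -(sum_emul_total n k ED) -prodrXr -big_split /=.
    apply: ler_prod => z _; rewrite exprn_ge0 //= -exprMn.
    by have [_ h] := hphi (s (esrc z)) (s (etgt z));
      rewrite lerXn2r ?nnegrE ?mulr_ge0 ?cmod_ge0.
  rewrite ler_wpM2l ?exprn_ge0 // (bigD1 s) //= lerDl.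
  by apply: sumr_ge0 => t _; exact: cmod_ge0.
apply: (@ratio_estimate_Bval n.+1 k D E q Lambda k_gt0 k_le q_gt0 E_gt0 E_lt kD L0
  _ _ (1 + M1 + M2)).
- by rewrite -addrA ltr_wpDr // addr_ge0.
- move=> al S0; have [i hi] := le_S al; exists i; apply/eqP.
  by rewrite eq_le Bval_ge0 andbT; rewrite S0 mulr0 in hi.
move=> al; set S := \sum_(s : 'S_n.+1) _ => S0.
have Bpos i : 0 < Bval k D E al i.
  rewrite lt_def Bval_ge0 andbT; apply: contraTneq S0 => h.
  by rewrite -leNgt; apply: le_trans (S_le al i) _; rewrite h mulr0.
rewrite mul1r; split.
  move=> i; split => //; rewrite ler_pdivlMr // ler_pdivrMl // mulrC.
  apply: le_trans (S_le al i) _; rewrite ler_wpM2r ?(ltW (Bpos i)) //; lra.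
have [i hi] := le_S al; exists i.
rewrite ler_pdivlMr // ler_pdivrMl //.
apply: le_trans hi _; rewrite mulrC ler_wpM2l ?(ltW S0) //; lra.
Qed.

End Estimates.

(** * The critical number of roots and the theorem *)

Lemma deg_le_family (N J : nat) (G : 'I_J -> zpoly N) :
  exists M : nat, forall m j, (M <= m)%N -> deg_le (G j) m.
Proof.
exists (\sum_j msize (G j))%N => m j h; apply: leqW; apply: leq_trans h.
by rewrite (bigD1 j) //= leq_addr.
Qed.

(* [k] is the smallest number of coinciding roots that makes the integral
   diverge. *)
Lemma critical_exponent (N D q : nat) : (0 < D)%N -> (0 < q)%N ->
  (forall k, 1 <= k <= N -> k * D <> 2 * q)%N ->
  (N * D < 2 * q)%N \/
  exists k E, [/\ (0 < k <= N)%N, (0 < E < D)%N & (k * D = 2 * q + E)%N].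
Proof.
move=> D0 q0 hres.
have ex_k : exists k, (2 * q < k * D)%N by exists (2 * q).+1; nia.
case: (ex_minnP ex_k) => k hk kmin.
have [Nk|kN] := ltnP N k.
  left; have h1 : (N * D <= 2 * q)%N.
    by rewrite leqNgt; apply/negP => /kmin; lia.
  have [N0|N0] := posnP N; first by rewrite N0; lia.
  have h2 := hres N; rewrite N0 leqnn in h2.
  by have := h2 isT; lia.
right; have k0 : (0 < k)%N by case: k hk {kmin kN}.
have h1 : (k.-1 * D <= 2 * q)%N.
  by rewrite leqNgt; apply/negP => /kmin; lia.
(* Non-resonance makes the inequality for [k - 1] strict, which is [E < D]. *)
have h2 : (k.-1 * D <> 2 * q)%N.
  have [k1|k1] := posnP k.-1; first by rewrite k1; lia.
  by apply: hres; lia.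
exists k, (k * D - 2 * q)%N; rewrite k0 kN; split => //; last by lia.
have : (k * D = k.-1 * D + D)%N by rewrite -{1}(prednK k0) mulSn addnC.
lia.
Qed.

Theorem theorem3 (R : realType) (N : nat) (Lambda : R) (delta : rat)
  (hLambda : 0 < Lambda) (hdelta : 0 < delta)
  (hres : forall k : nat, (1 <= k <= N)%N -> 2 / delta != k%:R) :
  (* (i) *)
  (exists (N' I J : nat) (eps' delta' : rat)
          (F : 'I_I -> zpoly N) (G : 'I_J -> zpoly N),
     (forall i, deg_le (F i) N') /\ (forall j, deg_le (G j) N') /\
     asymptotic_formula Lambda delta F G eps' delta')
  /\
  (* (ii) : if moreover delta < 4/N, one can take I = 1 and F_1 = 1 *)
  (delta * N%:R < 4 ->
   exists (N' J : nat) (eps' delta' : rat) (G : 'I_J -> zpoly N),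
     (forall j, deg_le (G j) N') /\
     asymptotic_formula Lambda delta (fun _ : 'I_1 => zpoly1 N)
       G eps' delta').
Proof.
pose q := `|denq delta|%N; pose D := `|numq delta|%N.
have q0 : (0 < q)%N by rewrite absz_gt0 denq_neq0.
have D0 : (0 < D)%N by rewrite absz_gt0 numq_eq0 gt_eqF.
have numE : numq delta = D%:Z by rewrite gez0_abs // numq_ge0 ltW.
have denE : denq delta = q%:Z by rewrite gez0_abs // denq_ge0.
have deltaE : delta = D%:R / q%:R by rewrite -[LHS]divq_num_den numE denE.
have ratrE : ratr delta = D%:R / q%:R :> R by rewrite /ratr numE denE.
have D_neq0 : D%:R != 0 :> rat by rewrite pnatr_eq0 -lt0n.
have q_neq0 : q%:R != 0 :> rat by rewrite pnatr_eq0 -lt0n.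
have hres' k : (1 <= k <= N)%N -> (k * D <> 2 * q)%N.
  move=> /hres/eqP hk kDq; apply: hk; rewrite deltaE invf_div mulrA.
  by rewrite -[2]/(2%:R) -natrM -kDq natrM mulfK.
(* If [N * delta < 2], the integral lies between constants, and constant families do. *)
have trivial_case : (N * D < 2 * q)%N ->
    asymptotic_formula Lambda delta (fun _ : 'I_1 => zpoly1 N)
      (fun _ : 'I_1 => zpoly1 N) (1 * 1)%:R^-1 (1 * 1)%:R^-1.
  move=> NDq; apply: (asymptotic_of_ratio _ (family_norm_one R N) (family_norm_one R N)) => //.
  by rewrite ratrE; exact: ratio_estimate_one.
have [dF hdF] := deg_le_family (fun _ : 'I_1 => zpoly1 N).
split.
- have [NDq|[k [E [/andP[k0 kN] /andP[E0 ED] kD]]]] := critical_exponent D0 q0 hres'.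
    exists dF, 1%N, 1%N; do 2!eexists; do 2!exists (fun _ : 'I_1 => zpoly1 N).
    by do 2![split; first by move=> j; exact: hdF]; exact: trivial_case.
  pose T := (E + (N - k) * D)%N.
  have [J [K1 [G [C1 hG]]]] := family_norm_sum R (@fden_perm N D T).
  have [I [K2 [F [C2 hF]]]] := family_norm_sum R (@fnum_perm N D T).
  have [dG hdG] := deg_le_family G; have [dF' hdF'] := deg_le_family F.
  exists (dG + dF')%N, I, J, (q * K2)%:R^-1, (q * K1)%:R^-1, F, G.
  split; first by move=> j; apply: hdF'; exact: leq_addl.
  split; first by move=> j; apply: hdG; exact: leq_addr.
  apply: (asymptotic_of_ratio q0 hG hF); rewrite ratrE.
  have := ratio_estimate_general k0 kN q0 E0 ED kD hLambda.
  congr (ratio_estimate _ _ _ _ _); apply/funext => al.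
    by rewrite sum_fden.
  by rewrite sum_fnum.
- move=> dN; have DN : (D * N < 4 * q)%N.
    move: dN; rewrite deltaE mulrAC ltr_pdivrMr ?ltr0n // -natrM.
    by rewrite -[4]/(4%:R) -natrM ltr_nat.
  have [NDq|[k [E [/andP[k0 kN] /andP[E0 ED] kD]]]] := critical_exponent D0 q0 hres'.
    exists dF, 1%N; do 2!eexists; exists (fun _ : 'I_1 => zpoly1 N).
    by split; [move=> j; exact: hdF | exact: trivial_case].
  case: N kN dN DN hres hres' trivial_case dF hdF => [|n] kN _ DN _ _ _ _ _.
    by lia.
  have [J [K1 [G [C1 hG]]]] := family_norm_sum R (@fedge_perm n k D E).
  have [dG hdG] := deg_le_family G.
  exists dG, J, (q * 1)%:R^-1, (q * K1)%:R^-1, G.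
  split; first by move=> j; exact: hdG.
  apply: (asymptotic_of_ratio q0 hG (family_norm_one R _)); rewrite ratrE.
  (* From [N * D < 4 * q = 2 * k * D - 2 * E] follow [N < 2 * k] and, when [N + 1 = 2 * k],
     [2 * E < D]. *)
  apply: ratio_estimate_edges => //; nia.
Qed.
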